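(* Assume Model M with draw probability $p=0$ or $p\in[1/3,1)$. Fix $t\in\mathbb{R}$ and define $S_n=\sum_{j=1}^n \mathbf{1}\{s_j^*>x_n(t)\}$. Then for every fixed integer $k\ge 0$, $$\lim_{n\to\infty}P(S_n=k)=e^{-\lambda(t)}\frac{\lambda(t)^k}{k!},\qquad \lambda(t)=e^{-t}.$$
   Context: Model M (round-robin tournament with $n$ players): for each ordered pair $i\neq j$ in $\{1,\dots,n\}$, $X_{ij}\in\{0,1/2,1\}$ is the score of player $i$ in the game against player $j$, with $X_{ij}+X_{ji}=1$; $P(X_{ij}=1/2)=p$ for all games and $P(X_{ij}=1)=P(X_{ji}=1)=(1-p)/2$; the $\binom{n}{2}$ pairs $(X_{ij},X_{ji})$, $i<j$, are mutually independent. The score of player $i$ is $s_i=\sum_{j\neq i}X_{ij}$, with $E(s_i)=(n-1)/2$ and standard deviation $\sigma_n=\sqrt{(n-1)(1-p)/4}$. The normalized score is $s_i^*=(s_i-(n-1)/2)/\sigma_n$. Set $a_n=(2\log n)^{-1/2}$, $b_n=(2\log n)^{1/2}-\tfrac12(2\log n)^{-1/2}(\log\log n+\log 4\pi)$, and $x_n(t)=a_nt+b_n$. *)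

(* Defs.v *)
From HB Require Import structures.
From mathcomp Require Import all_boot all_order all_algebra.
From mathcomp Require Import all_classical all_reals all_analysis.
Set Implicit Arguments. Unset Strict Implicit. Unset Printing Implicit Defensive.
Import Order.TTheory GRing.Theory Num.Theory.
Local Open Scope ring_scope.

(* Model M.  An outcome of the tournament among players 'I_n is a finite
   function w : 'I_n * 'I_n -> 'I_3.  For i < j, w (i,j) encodes the score of
   player i against j in half-points: 0 = loss, 1 = draw, 2 = win, so that
   X_ij = w(i,j)/2 and X_ji = 1 - X_ij.  Coordinates (i,j) with i >= j are
   unused dummies.  The probability is the product measure in which every
   coordinate has law  P(1) = p, P(0) = P(2) = (1-p)/2; the marginal of the
   used coordinates (i<j) is exactly Model M (independent games), and the
   dummy coordinates are independent of them and do not affect any event. *)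

Definition outcome (n : nat) := {ffun 'I_n * 'I_n -> 'I_3}.

Definition game_weight (R : realType) (p : R) (o : 'I_3) : R :=
  if val o == 1%N then p else (1 - p) / 2.

Definition outcome_weight (R : realType) (p : R) (n : nat) (w : outcome n) : R :=
  \prod_(ij : 'I_n * 'I_n) game_weight p (w ij).

Definition X (R : realType) (n : nat) (w : outcome n) (i j : 'I_n) : R :=
  if (i < j)%N then (val (w (i, j)))%:R / 2
  else if (j < i)%N then 1 - (val (w (j, i)))%:R / 2
  else 0.

Definition score (R : realType) (n : nat) (w : outcome n) (i : 'I_n) : R :=
  \sum_(j : 'I_n | j != i) X R w i j.

Definition sigma_n (R : realType) (p : R) (n : nat) : R :=
  Num.sqrt ((n.-1)%:R * (1 - p) / 4).

Definition norm_score (R : realType) (p : R) (n : nat) (w : outcome n) (i : 'I_n) : R :=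
  (score R w i - (n.-1)%:R / 2) / sigma_n p n.

Definition a_n (R : realType) (n : nat) : R := (Num.sqrt (2 * ln (n%:R : R)))^-1.

Definition b_n (R : realType) (n : nat) : R :=
  Num.sqrt (2 * ln (n%:R : R))
  - 2^-1 * (Num.sqrt (2 * ln (n%:R : R)))^-1 * (ln (ln (n%:R : R)) + ln (4 * pi)).

Definition x_n (R : realType) (n : nat) (t : R) : R := a_n R n * t + b_n R n.

Definition S_n (R : realType) (p : R) (n : nat) (t : R) (w : outcome n) : nat :=
  #|[set j : 'I_n | x_n n t < norm_score p w j]|.

Definition prob_S_eq (R : realType) (p : R) (t : R) (k n : nat) : R :=
  \sum_(w : outcome n | S_n p t w == k) outcome_weight p w.

(* Main.v *)
Require Import Defs.
From HB Require Import structures.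
From mathcomp Require Import all_boot all_order all_algebra.
From mathcomp Require Import all_classical all_reals all_analysis.
From mathcomp Require Import ring lra.
Import Order.TTheory GRing.Theory Num.Theory.
Import numFieldNormedType.Exports.
Set Implicit Arguments. Unset Strict Implicit. Unset Printing Implicit Defensive.
Local Open Scope classical_set_scope.
Local Open Scope ring_scope.


(* Put T_j = 2 s_j - (n - 1), a sum of n - 1 increments in {-1, 0, 1} of variance v = 1 - p;
   player j exceeds the level iff T_j > x_n sqrt((n - 1) v).  For a set J of r players, split
   T_j into the games against players outside J, which are independent over j in J, and the
   games inside J, which contribute at most r.  Hence P(all of J exceed) lies between the r-th
   powers of the tails of the (n - r)-step walk at the level shifted by + r and - r.

   These tails are compared with the Gaussian tail by Lindeberg's replacement method, started
   from a Gaussian of variance n v / (ln n)^4 that smooths the indicator.  The third derivative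
   of the heat kernel is controlled by an exponential supermartingale of size about n^(-3/4) at
   this level, so n steps of error n^(-3/2) (ln n)^6 cost o(1/n) in all.  Mills' bounds then give
   n P(T_j > level) -> e^(-t), whence E binom(S_n, r) -> e^(-rt) / r!, and the truncated
   inclusion-exclusion inequalities turn the factorial moments into the Poisson limit. *)

(** * The standard Gaussian tail: derivative, symmetry and Mills' bounds *)

Section gaussian_tail.
Context {R : realType}.
Implicit Types x y z : R.

Lemma mean_value (f df : R -> R) (a b : R) : a < b ->
  (forall x, a <= x <= b -> is_derive x 1 f (df x)) ->
  exists2 c, a < c < b & f b - f a = df c * (b - a).
Proof.
move=> ab dfx; have [||c cab fba] := @MVT R f df a b ab.
- by move=> x; rewrite in_itv/= => /andP[ax xb]; apply: dfx; rewrite !ltW.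
- apply: derivable_within_continuous => x; rewrite in_itv/= => xab.
  by have := dfx _ xab; case.
by exists c => //; move: cab; rewrite in_itv.
Qed.

Definition gauss_pdf x : R := (Num.sqrt (2 * pi))^-1 * expR (- (x ^+ 2 / 2)).

(** The upper tail at [x], written by symmetry as an integral from [-oo], so that it is a
    distribution function at [- x] and the fundamental theorem of calculus applies on a left
    half-line. *)
Definition gauss_tail x : R :=
  \int[lebesgue_measure]_(u in `]-oo, - x]) gauss_pdf u.

Lemma gauss_pdf_ge0 x : 0 <= gauss_pdf x.
Proof. by rewrite mulr_ge0 ?expR_ge0// invr_ge0 sqrtr_ge0. Qed.

Lemma normal_pdf01E : normal_pdf 0 1 = gauss_pdf.
Proof.
apply/funext => x; rewrite /normal_pdf oner_eq0 /gauss_pdf.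
rewrite /normal_peak /normal_fun.
by rewrite expr1n mul1r subr0 -[pi *+ 2]mulr_natl -[1 *+ 2]/(2%:R) mulNr.
Qed.

Lemma gauss_tailE x :
  gauss_tail x = fine (normal_prob (0 : R) 1 `]-oo, - x]%classic).
Proof. by rewrite /gauss_tail /Rintegral /normal_prob normal_pdf01E. Qed.

Lemma gauss_tail_ge0 x : 0 <= gauss_tail x.
Proof. by rewrite gauss_tailE fine_ge0. Qed.

Lemma gauss_tail_le1 x : gauss_tail x <= 1.
Proof.
rewrite gauss_tailE -lee_fin fineK ?fin_num_measure//.
exact: probability_le1.
Qed.

(** The identity as a random variable under the normal law: its [cdf] is the Gaussian distribution
    function, whose limits at both infinities become those of [gauss_tail]. *)
Let idTR : measurableTypeR R -> R := idfun.

#[local] HB.instance Definition _ :=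
  @isMeasurableFun.Build _ _ _ _ idTR (@measurable_id _ _ setT).

Lemma gauss_tail_cvgy : gauss_tail x @[x --> +oo] --> (0 : R).
Proof.
have := @cvg_cdfNy0 _ _ _ _ (idTR : {RV normal_prob (0 : R) 1 >-> R}).
move=> /fine_cvg.
move=> H; have : (fine \o cdf (idTR : {RV normal_prob (0 : R) 1 >-> R})) (- x)
    @[x --> +oo] --> (0 : R).
  by move/cvgNy_compNP : H.
apply: cvg_trans; apply: near_eq_cvg; near=> x => /=.
by rewrite gauss_tailE.
Unshelve. all: by end_near. Qed.

Lemma is_derive_gauss_pdf x : is_derive x 1 gauss_pdf (- x * gauss_pdf x).
Proof.
rewrite /gauss_pdf.
have h : is_derive x 1 (fun y : R => - (y ^+ 2 / 2)) (- x).
  have -> : (fun y : R => - (y ^+ 2 / 2)) = (- 2^-1) \*: (fun y : R => y ^+ 2).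
    by apply/funext => y /=; rewrite /GRing.scale/= mulNr mulrC.
  apply: is_derive_eq; rewrite /GRing.scale/=.
  by field.
have h2 := @is_derive1_comp R expR _ x _ _ (is_derive_expR _) h.
have := @is_deriveZ R _ R _ (Num.sqrt (2 * pi))^-1 x 1 _ h2.
rewrite /GRing.scale/= => h3.
apply: is_derive_eq; rewrite /=; ring.
Qed.

Lemma continuous_gauss_pdf : continuous gauss_pdf.
Proof. by rewrite -normal_pdf01E; exact: continuous_normal_pdf. Qed.

Lemma is_derive_gauss_tail x : is_derive x 1 gauss_tail (- gauss_pdf x).
Proof.
have xu : - x < - x + 1 by rewrite ltrDl.
have int : lebesgue_measure.-integrable
    [set` Interval -oo%O (BRight (- x + 1))] (EFin \o gauss_pdf).
  apply: (@integrableS _ _ _ _ setT) => //.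
  by rewrite -normal_pdf01E; exact: integrable_normal_pdf.
have [d1 d2] := @continuous_FTC1 R gauss_pdf _ (- x) _ xu int (ltNyr _)
  (@continuous_gauss_pdf _).
have -> : - gauss_pdf x = gauss_pdf (- x) * (- 1) by rewrite /gauss_pdf sqrrN mulrN1.
pose F y := \int[lebesgue_measure]_(u in `]-oo, y]) gauss_pdf u.
have -> : gauss_tail = F \o -%R by [].
apply: is_derive1_comp.
by split => //; rewrite -derive1E.
Qed.

Lemma gauss_tail_decr x y : x <= y -> gauss_tail y <= gauss_tail x.
Proof.
rewrite le_eqVlt => /predU1P[->//|xy].
have [z _ e] := mean_value xy (fun z _ => is_derive_gauss_tail z).
rewrite -subr_le0 e mulNr oppr_le0 mulr_ge0 ?gauss_pdf_ge0//.
by rewrite subr_ge0 ltW.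
Qed.

Lemma gauss_tail_cvgNy : gauss_tail (- x) @[x --> +oo] --> (1 : R).
Proof.
have := @cvg_cdfy1 _ _ _ _ (idTR : {RV normal_prob (0 : R) 1 >-> R}).
move=> /fine_cvg; apply: cvg_trans; apply: near_eq_cvg; near=> x => /=.
by rewrite gauss_tailE opprK.
Unshelve. all: by end_near. Qed.

(** The sum of the tails at [y] and [- y] has zero derivative, and its limit at [+oo] is 1. *)
Lemma gauss_tailN x : gauss_tail (- x) = 1 - gauss_tail x.
Proof.
pose G y := gauss_tail (- y) + gauss_tail y.
have cst y z : G y = G z.
  apply: is_derive_0_is_cst => u.
  have h1 := @is_derive1_comp R gauss_tail -%R u _ _
     (is_derive_gauss_tail _) (is_deriveNid _ _).
  have h2 := @is_deriveD R _ R _ _ u 1 _ _ h1 (is_derive_gauss_tail u).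
  apply: is_derive_eq.
  by rewrite /gauss_pdf sqrrN; ring.
have : G y @[y --> +oo] --> (1 + 0 : R).
  by apply: cvgD; [exact: gauss_tail_cvgNy|exact: gauss_tail_cvgy].
rewrite addr0.
have : G y @[y --> +oo] --> G x.
  have -> : G = (fun _ => G x) by apply/funext => y; exact: cst.
  exact: cvg_cst.
move=> h1 h2; have e : G x = 1 by apply: (cvg_unique _ h1 h2).
by rewrite -e /G addrK.
Qed.

(** A function that decreases to 0 is nonnegative. Both Mills bounds follow from this by the sign of
    one derivative. *)
Lemma ge0_of_derive_le0 (f df : R -> R) x :
  (forall y, x <= y -> is_derive y 1 f (df y)) ->
  (forall y, x <= y -> df y <= 0) ->
  f y @[y --> +oo] --> (0 : R) -> 0 <= f x.
Proof.
move=> dfx df0 fy.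
apply: (cvgr_to_le fy).
near=> y.
have xy : x < y by near: y; apply: nbhs_pinfty_gt; rewrite num_real.
have [|z /andP[xz _] e] := @mean_value f df x y xy.
  by move=> z /andP[xz _]; exact: dfx.
rewrite -subr_le0 e mulr_le0_ge0 ?subr_ge0 ?(ltW xy)//.
by apply: df0; exact: ltW.
Unshelve. all: by end_near. Qed.

Lemma cvgV_pinfty : x^-1 @[x --> +oo] --> (0 : R).
Proof.
by apply/gtr0_cvgV0; [near=> x; near: x; apply: nbhs_pinfty_gt; rewrite num_real|exact: cvg_id].
Unshelve. all: by end_near. Qed.

Lemma gauss_pdf_cvgy : gauss_pdf x @[x --> +oo] --> (0 : R).
Proof.
rewrite -(mulr0 (Num.sqrt (2 * pi))^-1).
apply: cvgM; first exact: cvg_cst.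
apply: (@squeeze_cvgr _ _ _ _ (cst 0) (fun x => 2 * x^-1)).
- near=> x.
  have x0 : 0 < x by near: x; apply: nbhs_pinfty_gt; rewrite num_real.
  have x1 : 1 < x by near: x; apply: nbhs_pinfty_gt; rewrite num_real.
  rewrite expR_ge0 expRN /=.
  rewrite -[2]invrK -invfM lef_pV2 ?posrE ?expR_gt0 ?mulr_gt0//.
  apply: le_trans (expR_ge1Dx _); rewrite mulrC; nra.
- exact: cvg_cst.
- rewrite -[X in _ --> X](mulr0 2); apply: cvgM; first exact: cvg_cst.
  exact: cvgV_pinfty.
Unshelve. all: by end_near. Qed.

Lemma is_derive_inv x : x != 0 -> is_derive x 1 (fun y : R => y^-1) (- (x ^- 2)).
Proof.
move=> x0; have := @is_deriveV R id x 1 1 x0 _ => h.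
by apply: is_derive_eq; rewrite /GRing.scale/= mulr1.
Qed.

Lemma gauss_tail_le x : 0 < x -> gauss_tail x <= gauss_pdf x / x.
Proof.
move=> x0; rewrite -subr_ge0.
apply: (@ge0_of_derive_le0
  (fun x => gauss_pdf x * x^-1 - gauss_tail x)
  (fun x => - (gauss_pdf x * x^-2))).
- move=> y xy; have y0 : y != 0 by rewrite gt_eqF// (lt_le_trans x0).
  have h1 := @is_deriveM R _ _ _ _ _ _ _ (is_derive_gauss_pdf y) (is_derive_inv y0).
  have h2 := @is_deriveB R _ R _ _ y 1 _ _ h1 (is_derive_gauss_tail y).
  by apply: is_derive_eq; rewrite /GRing.scale/=; field.
- by move=> y xy; rewrite oppr_le0 mulr_ge0 ?gauss_pdf_ge0// invr_ge0 sqr_ge0.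
- rewrite -[X in _ --> X](subr0 0) -[X in X - _](mulr0 0).
  apply: cvgB; last exact: gauss_tail_cvgy.
  by apply: cvgM; [exact: gauss_pdf_cvgy|exact: cvgV_pinfty].
Qed.

(** The correction [x^-1 ^+ 3] is the next term of the asymptotic expansion of the Mills ratio;
    after cancellation the difference has derivative [- 3 * gauss_pdf x / x ^+ 4]. *)
Lemma gauss_tail_ge x : 0 < x -> gauss_pdf x * (x^-1 - x^-1 ^+ 3) <= gauss_tail x.
Proof.
move=> x0; rewrite -subr_ge0.
apply: (@ge0_of_derive_le0
  (fun x => gauss_tail x - gauss_pdf x * (x^-1 - x^-1 ^+ 3))
  (fun x => - (3 * gauss_pdf x * x^-1 ^+ 4))).
- move=> y xy; have y0 : y != 0 by rewrite gt_eqF// (lt_le_trans x0).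
  have h0 := is_deriveB (is_derive_inv y0) (is_deriveX 3 (is_derive_inv y0)).
  have h1 := is_deriveM (is_derive_gauss_pdf y) h0.
  have h2 := is_deriveB (is_derive_gauss_tail y) h1.
  by apply: is_derive_eq; rewrite /GRing.scale !fctE /=; field.
- move=> y xy; have y0 : 0 <= y^-1 by rewrite invr_ge0 (le_trans (ltW x0)).
  by rewrite oppr_le0 !mulr_ge0 ?gauss_pdf_ge0.
- rewrite -[X in _ --> X](subr0 0) -[X in _ - X](mulr0 0).
  apply: cvgB; first exact: gauss_tail_cvgy.
  apply: cvgM; first exact: gauss_pdf_cvgy.
  rewrite -[X in _ --> X](subr0 0) -[X in _ - X](expr0n _ 3).
  apply: cvgB; first exact: cvgV_pinfty.
  exact: (cvg_comp _ _ cvgV_pinfty (@exprn_continuous _ _ _)).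
Qed.

End gaussian_tail.

(** * One step of the walk against one step of the heat flow *)

Section random_walk.
Context {R : realType} (p : R).
Hypotheses (p_ge0 : 0 <= p) (p_lt1 : p < 1).
Implicit Types (f g : R -> R) (s w y l : R).

(* One step of a walk with increments -1, 0, 1: this is [2 X_ij - 1] in the tournament. *)
Definition walk_step f w : R := p * f w + (1 - p) / 2 * (f (w + 1) + f (w - 1)).

Lemma ler_walk_step f g w : (forall x, f x <= g x) -> walk_step f w <= walk_step g w.
Proof.
move=> fg; have v0 : 0 <= (1 - p) / 2 by rewrite divr_ge0// subr_ge0 ltW.
by rewrite lerD ?ler_wpM2l// lerD.
Qed.

Lemma iter_walk_step_le k f g w :
  (forall x, f x <= g x) -> iter k walk_step f w <= iter k walk_step g w.
Proof.
move=> fg; elim: k w => //= k ih w; exact: ler_walk_step.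
Qed.

Lemma iter_walk_step_addc k f a w :
  iter k walk_step (fun x => f x + a) w = iter k walk_step f w + a.
Proof. by elim: k w => //= k ih w; rewrite /walk_step !ih; lra. Qed.

(* With [w] the position and [s] the remaining variance, [gauss_kernel y] solves the heat
   equation [dF/ds = F_ww / 2], and [exp_bound y l] is a supersolution of the walk recursion
   that dominates its third derivative through the Chernoff bound [z^2/2 >= l z - l^2/2]. *)
Definition gauss_kernel y s w := gauss_tail ((y - w) / Num.sqrt s).
Definition exp_bound y l s w := expR (3 / 4 * (l ^+ 2 * s / 2 - l * (y - w))).

(** A step multiplies the exponential by [p + (1 - p) cosh (3 l / 4)]. For [l <= 1/2] the cosine is
    at most [1 + 3 l^2 / 8], and the added variance supplies the factor
    [expR ((1 - p) * 3 l^2 / 8)]. The prefactor 3/4 gives the room: the true quadratic coefficient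
    is 9/32. *)
Lemma exp_bound_step y l s w : 0 <= l <= 2^-1 ->
  walk_step (exp_bound y l s) w <= exp_bound y l (s + (1 - p)) w.
Proof.
move=> /andP[l0 l1].
rewrite /walk_step.
set c := 3 / 4 * (l ^+ 2 * s / 2 - l * (y - w)).
(* Half of the exponent step: as [e^(2u) + e^(-2u) - 2 = (e^u - e^(-u))^2], a linear bound on the
   difference gives the quadratic bound on the cosine. *)
pose u := 3 / 8 * l.
have -> : exp_bound y l s (w + 1) = expR c * (expR u * expR u).
  by rewrite /exp_bound -!expRD; congr expR; rewrite /c /u; field.
have -> : exp_bound y l s (w - 1) = expR c * (expR (- u) * expR (- u)).
  by rewrite /exp_bound -!expRD; congr expR; rewrite /c /u; field.
have -> : exp_bound y l (s + (1 - p)) w = expR c * expR ((1 - p) * (3 / 8 * l ^+ 2)).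
  by rewrite /exp_bound -!expRD; congr expR; rewrite /c /u; field.
have -> : exp_bound y l s w = expR c by [].
have c0 : 0 < expR c := expR_gt0 _.
have hu : expR u * expR (- u) = 1 by rewrite -expRD subrr expR0.
have u0 : 0 <= u by rewrite /u; lra.
have u1 : u <= 1 / 5 by rewrite /u; lra.
have hm : 1 - u <= expR (- u) by apply: expR_ge1Dx.
have e0 : 0 < expR u := expR_gt0 _.
have hp : expR u * (1 - u) <= 1 by rewrite -[leRHS]hu ler_wpM2l// ltW.
have hd0 : 0 <= expR u - expR (- u).
  by rewrite subr_ge0 ler_expR; lra.
have hd : (expR u - expR (- u)) * (8 / 9) <= 2 * u.
  suff : expR u - expR (- u) <= 9 / 4 * u by move=> h; lra.
  have : expR u <= 1 + 5 / 4 * u by nra.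
  by move=> h; lra.
have hq : expR u * expR u + expR (- u) * expR (- u) <= 2 + 2 * (3 / 8 * l ^+ 2).
  have : (expR u - expR (- u)) ^+ 2 <= (9 / 4 * u) ^+ 2.
    by rewrite ler_sqr ?nnegrE//; lra.
  rewrite /u in hd0 hd hu u0 u1 *.
  move=> h; rewrite !expr2 in h *; nra.
have he : 1 + (1 - p) * (3 / 8 * l ^+ 2) <= expR ((1 - p) * (3 / 8 * l ^+ 2)).
  exact: expR_ge1Dx.
apply: le_trans (ler_wpM2l (ltW c0) he).
have -> : p * expR c + (1 - p) / 2 *
   (expR c * (expR u * expR u) + expR c * (expR (- u) * expR (- u))) =
  expR c * (p + (1 - p) / 2 * (expR u * expR u + expR (- u) * expR (- u))) by lra.
rewrite ler_wpM2l ?(ltW c0)//.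
have v0 : 0 <= (1 - p) / 2 by rewrite divr_ge0// subr_ge0 ltW.
have := ler_wpM2l v0 hq; lra.
Qed.

(** With the level raised by [rho] standard deviations, the smoothed indicator is at most
    [gauss_tail rho] wherever the sharp one vanishes, and at most 1 elsewhere. *)
Lemma gauss_kernel_lower c s rho w : 0 < s ->
  gauss_kernel (c + Num.sqrt s * rho) s w - gauss_tail rho <= ((c < w)%R)%:R.
Proof.
move=> s0; have q0 : 0 < Num.sqrt s by rewrite sqrtr_gt0.
have [cw|wc] := ltP c w.
  rewrite (le_trans _ (gauss_tail_le1 ((c + Num.sqrt s * rho - w) / Num.sqrt s)))//.
  by rewrite lerBlDr lerDl gauss_tail_ge0.
rewrite subr_le0; apply: gauss_tail_decr.
rewrite ler_pdivlMr//; lra.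
Qed.

(** With the level lowered by [rho] standard deviations, the smoothed indicator is at least
    [1 - gauss_tail rho] wherever the sharp one is 1. *)
Lemma gauss_kernel_upper c s rho w : 0 < s ->
  ((c < w)%R)%:R <= gauss_kernel (c - Num.sqrt s * rho) s w + gauss_tail rho.
Proof.
move=> s0; have q0 : 0 < Num.sqrt s by rewrite sqrtr_gt0.
have [cw|wc] := ltP c w; last by rewrite addr_ge0 ?gauss_tail_ge0.
rewrite -lerBlDr -gauss_tailN; apply: gauss_tail_decr.
by rewrite ler_pdivrMr//; lra.
Qed.

(** [- gauss_d1 q], [gauss_d2 q] and [gauss_d3 q] are the first three derivatives of
    [a |-> gauss_tail (a / q)]. *)
Definition gauss_d1 (q a : R) : R := gauss_pdf (a / q) / q.
Definition gauss_d2 (q a : R) : R := gauss_pdf (a / q) * (a / q) / q ^+ 2.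
Definition gauss_d3 (q a : R) : R := gauss_pdf (a / q) * (1 - (a / q) ^+ 2) / q ^+ 3.

Lemma is_derive_gauss_d1 (q a : R) : q != 0 ->
  is_derive a 1 (gauss_d1 q) (- gauss_d2 q a).
Proof.
move=> q0; rewrite /gauss_d1 /gauss_d2.
have h : is_derive a 1 (fun y : R => q^-1 *: y) (q^-1 *: 1).
  exact: is_deriveZ.
have h1 := is_derive1_comp (is_derive_gauss_pdf (q^-1 *: a)) h.
have h2 := is_deriveZ q^-1 h1.
have -> : (fun a => gauss_pdf (a / q) / q) =
   q^-1 *: (gauss_pdf \o (fun y : R => q^-1 *: y)).
  by apply/funext => y; rewrite !fctE /GRing.scale/= mulrC [q^-1 * y]mulrC.
apply: is_derive_eq; rewrite /GRing.scale/= [q^-1 * a]mulrC; field.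
exact: q0.
Qed.

Lemma is_derive_gauss_d2 (q a : R) : q != 0 ->
  is_derive a 1 (gauss_d2 q) (gauss_d3 q a).
Proof.
move=> q0; rewrite /gauss_d2 /gauss_d3.
have h : is_derive a 1 (fun y : R => q^-1 *: y) (q^-1 *: 1).
  exact: is_deriveZ.
have h1 := is_derive1_comp (is_derive_gauss_pdf (q^-1 *: a)) h.
have h2 := is_deriveZ (q^-1 ^+ 2) (is_deriveM h1 h).
have -> : (fun a => gauss_pdf (a / q) * (a / q) / q ^+ 2) =
   (q^-1 ^+ 2) *: ((gauss_pdf \o (fun y : R => q^-1 *: y)) * (fun y : R => q^-1 *: y)).
  apply/funext => y; rewrite !fctE /GRing.scale/=.
  by rewrite mulrC [q^-1 * y]mulrC exprVn.
apply: is_derive_eq; rewrite /GRing.scale/= [q^-1 * a]mulrC; field.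
exact: q0.
Qed.

Lemma gauss_pdf_le (z : R) : gauss_pdf z <= expR (- (z ^+ 2 / 2)).
Proof.
rewrite /gauss_pdf ler_piMl ?expR_ge0// invf_le1.
  rewrite -[leLHS]sqrtr1 ler_sqrt ?mulr_ge0 ?pi_ge0//.
  by have := @pi_ge2 R; lra.
by rewrite sqrtr_gt0 mulr_gt0 ?pi_gt0.
Qed.

(** The polynomial factor is absorbed by [1 + z^2 <= 8 e^(z^2/8)], which lowers the Gaussian
    exponent from 1/2 to 3/8; this is the source of the 3/4 in [exp_bound]. *)
Lemma gauss_d3_le (q a : R) : 0 < q ->
  `|gauss_d3 q a| <= 8 / q ^+ 3 * expR (- (3 / 8 * (a / q) ^+ 2)).
Proof.
move=> q0; rewrite /gauss_d3; set z := a / q.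
have q30 : 0 < q ^+ 3 by rewrite exprn_gt0.
rewrite normrM normfV (ger0_norm (ltW q30)) [leRHS]mulrAC ler_pM2r ?invr_gt0//.
rewrite normrM ger0_norm ?gauss_pdf_ge0//.
have z2 : 0 <= z ^+ 2 by rewrite sqr_ge0.
have h1 : `|1 - z ^+ 2| <= 8 * expR (z ^+ 2 / 8).
  apply: (@le_trans _ _ (1 + z ^+ 2)).
    by rewrite ler_norml; apply/andP; split; lra.
  by have := expR_ge1Dx (z ^+ 2 / 8); lra.
apply: (le_trans (ler_pM _ _ (gauss_pdf_le z) h1)); rewrite ?gauss_pdf_ge0//.
rewrite mulrCA -expRD ler_pM2l// ler_expR; lra.
Qed.

(** By the heat equation the derivative in the variance is half the second space derivative; the
    variance moves at rate [- 2 v th], whence the term in [gauss_d2]. *)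
Lemma is_derive_gauss_tail_scaled (S v a c th : R) : v * th ^+ 2 < S ->
  is_derive th 1
    (fun th => gauss_tail ((a - c * th) / Num.sqrt (S - v * th ^+ 2)))
    (c * gauss_d1 (Num.sqrt (S - v * th ^+ 2)) (a - c * th)
     - v * th * gauss_d2 (Num.sqrt (S - v * th ^+ 2)) (a - c * th)).
Proof.
move=> vS; set q := Num.sqrt (S - v * th ^+ 2).
have q2 : 0 < S - v * th ^+ 2 by rewrite subr_gt0.
have q0 : 0 < q by rewrite sqrtr_gt0.
have qn : q != 0 by rewrite gt_eqF.
have qq : q ^+ 2 = S - v * th ^+ 2 by rewrite sqr_sqrtr ?ltW.
have h1 : is_derive th 1 (fun u : R => S - v * u ^+ 2) (- (2 * v * th)).
  have -> : (fun u : R => S - v * u ^+ 2) = cst S - v *: (fun u : R => u ^+ 2) by [].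
  by apply: is_derive_eq; rewrite /GRing.scale/=; ring.
have h2 : is_derive th 1 (fun u : R => Num.sqrt (S - v * u ^+ 2)) (- (v * th) / q).
  have := @is_derive1_comp R Num.sqrt (fun u => S - v * u ^+ 2) th _ _ (is_derive1_sqrt q2) h1.
  have -> : (2 * Num.sqrt (S - v * th ^+ 2))^-1 * - (2 * v * th) = - (v * th) / q.
    by rewrite -/q; field.
  by [].
have h3 := @is_deriveV R (fun u => Num.sqrt (S - v * u ^+ 2)) th _ _ qn h2.
have h4 : is_derive th 1 (fun u : R => a - c * u) (- c).
  have -> : (fun u : R => a - c * u) = cst a - c *: id by [].
  by apply: is_derive_eq; rewrite /GRing.scale/=; ring.
have h5 := @is_deriveM R R (fun u => a - c * u) _ th _ _ _ h4 h3.
have h6 := @is_derive1_comp R gauss_tail _ th _ _ (is_derive_gauss_tail _) h5.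
apply: is_derive_eq.
rewrite /GRing.scale !fctE /= -/q /gauss_d1 /gauss_d2.
by field.
Qed.

(** The prefactor is taken at the least variance [s0] and the exponent at the greatest, [S].
    Replacing [u] by [a - 1] costs the factor [expR (3 / 4 * l)]. *)
Lemma gauss_d3_bound (s0 S l a Q u : R) : 0 < s0 -> 0 <= l ->
  0 < Q -> s0 <= Q ^+ 2 -> Q ^+ 2 <= S -> a - 1 <= u ->
  `|gauss_d3 Q u| <=
  8 / Num.sqrt s0 ^+ 3 * expR (3 / 4 * l + 3 / 4 * (l ^+ 2 * S / 2 - l * a)).
Proof.
move=> s00 l0 Q0 sQ QS au; apply: (le_trans (gauss_d3_le _ Q0)).
have r0 : 0 < Num.sqrt s0 by rewrite sqrtr_gt0.
have rQ : Num.sqrt s0 <= Q.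
  by rewrite -[leRHS](ger0_norm (ltW Q0)) -sqrtr_sqr ler_wsqrtr.
apply: ler_pM.
- by rewrite divr_ge0// exprn_ge0// ltW.
- exact: expR_ge0.
- rewrite ler_wpM2l// lef_pV2 ?posrE ?exprn_gt0//.
  by rewrite ler_pXn2r// ?nnegrE ltW.
rewrite ler_expR.
(* The Chernoff bound: the exponent is replaced by its tangent, linear in [u]. *)
have hz : 2 * (l * u) - l ^+ 2 * Q ^+ 2 <= (u / Q) ^+ 2.
  rewrite -subr_ge0.
  have -> : (u / Q) ^+ 2 - (2 * (l * u) - l ^+ 2 * Q ^+ 2) = (u / Q - l * Q) ^+ 2.
    by field; rewrite gt_eqF.
  exact: sqr_ge0.
have h1 : l * a - l <= l * u by have := ler_wpM2l l0 au; lra.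
have h2 : l ^+ 2 * Q ^+ 2 <= l ^+ 2 * S by rewrite ler_wpM2l ?sqr_ge0.
move: (u / Q) (l ^+ 2 * Q ^+ 2) (l ^+ 2 * S) (l * u) (l * a) hz h1 h2 => *; lra.
Qed.

(** The two [gauss_d1] terms differ by [2 th] times a value of [gauss_d2], and since [p + v = 1]
    this cancels the [gauss_d2] terms to leading order. What remains are differences of [gauss_d2]
    between points of [[a - 1, a + 1]], each at most [2 M]. *)
Lemma gauss_d2_average (M Q a th v : R) : v = 1 - p -> 0 < Q -> 0 < th < 1 -> 0 <= M ->
  (forall u, a - 1 <= u -> `|gauss_d3 Q u| <= M) ->
  `|p * (0 * gauss_d1 Q (a - 0 * th) - v * th * gauss_d2 Q (a - 0 * th)) +
    v / 2 * ((1 * gauss_d1 Q (a - 1 * th) - v * th * gauss_d2 Q (a - 1 * th)) +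
      ((-1) * gauss_d1 Q (a - (-1) * th) - v * th * gauss_d2 Q (a - (-1) * th)))|
  <= M * 2.
Proof.
move=> vE q0 /andP[t0 t1] M0 d3M.
have v0 : 0 < v by rewrite vE subr_gt0.
have v1 : v <= 1 by rewrite vE lerBlDr lerDl.
have lip u1 u2 : a - 1 <= u1 -> u1 < u2 -> u2 - u1 <= 2 ->
    `|gauss_d2 Q u2 - gauss_d2 Q u1| <= M * 2.
  move=> au u12 u2u1.
  have [|z /andP[z1 _] ez] := @mean_value _ (gauss_d2 Q) (gauss_d3 Q) _ _ u12.
    by move=> x _; apply: is_derive_gauss_d2; rewrite gt_eqF.
  rewrite ez normrM [X in _ * X]gtr0_norm ?subr_gt0// ler_pM//.
    by rewrite subr_ge0 ltW.
  by apply: d3M; apply: le_trans au (ltW z1).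
have ord : a - th < a + th by lra.
have [|xi /andP[xi1 xi2] exi] := @mean_value _ (gauss_d1 Q) (fun u => - gauss_d2 Q u) _ _ ord.
  by move=> x _; apply: is_derive_gauss_d1; rewrite gt_eqF.
have b1 : `|gauss_d2 Q xi - gauss_d2 Q (a - th)| <= M * 2 by apply: lip; lra.
have b2 : `|gauss_d2 Q (a + th) - gauss_d2 Q xi| <= M * 2 by apply: lip; lra.
have b3 : `|gauss_d2 Q a - gauss_d2 Q xi| <= M * 2.
  have [xa|ax|->] := ltgtP xi a; last by rewrite subrr normr0 mulr_ge0.
  - by apply: lip; lra.
  - by rewrite distrC; apply: lip; lra.
rewrite !mul0r subr0 !mul1r !mulN1r opprK sub0r.
have -> : gauss_d1 Q (a - th) = gauss_d1 Q (a + th) + 2 * th * gauss_d2 Q xi by lra.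
move: b1 b2 b3 {exi d3M lip}.
move: (gauss_d2 Q xi) (gauss_d2 Q (a - th)) (gauss_d2 Q (a + th)) (gauss_d2 Q a)
  (gauss_d1 Q (a + th)) => X Ym Yp Y D b1 b2 b3.
have -> : p * - (v * th * Y) + v / 2 * (D + 2 * th * X - v * th * Ym + (- D - v * th * Yp))
  = v * th * (- p * (Y - X) + v / 2 * (X - Ym) + - (v / 2) * (Yp - X)).
  by rewrite vE; field.
have vth0 : 0 <= v * th by rewrite mulr_ge0// ltW.
have vth : v * th <= 1 by rewrite mulr_ile1// ltW.
rewrite normrM ger0_norm// -[leRHS]mul1r ler_pM//.
have -> : M * 2 = p * (M * 2) + v / 2 * (M * 2) + v / 2 * (M * 2) by rewrite vE; field.
have v20 : 0 <= v / 2 by rewrite divr_ge0// ltW.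
apply: le_trans (ler_normD _ _) _; apply: lerD.
  apply: le_trans (ler_normD _ _) _; apply: lerD; rewrite normrM ?normrN;
  [rewrite [`|p|]ger0_norm//|rewrite [`|v / 2|]ger0_norm//]; exact: ler_wpM2l.
by rewrite normrM normrN [`|v / 2|]ger0_norm//; exact: ler_wpM2l.
Qed.

Lemma is_derive_average (a b x d0 d1 d2 : R) (f0 f1 f2 : R -> R) :
  is_derive x 1 f0 d0 -> is_derive x 1 f1 d1 -> is_derive x 1 f2 d2 ->
  is_derive x 1 (fun u => a * f0 u + b * (f1 u + f2 u)) (a * d0 + b * (d1 + d2)).
Proof.
move=> h0 h1 h2.
exact: is_deriveD (is_deriveZ a h0) (is_deriveZ b (is_deriveD h1 h2)).
Qed.

(* Lindeberg interpolation: the increment is shrunk by [th] from 1 to 0 while the variance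
   [v (1 - th^2)] lost on the way is given to the Gaussian part. *)
Lemma walk_step_gauss_kernel y s s0 l w : 0 < s0 -> s0 <= s -> 0 <= l ->
  `|walk_step (gauss_kernel y s) w - gauss_kernel y (s + (1 - p)) w| <=
  16 / Num.sqrt s0 ^+ 3 * expR (3 / 4 * l) * exp_bound y l (s + (1 - p)) w.
Proof.
move=> s00 ss0 l0.
set v := 1 - p; set S := s + v; pose a := y - w.
have v0 : 0 < v by rewrite subr_gt0.
have v1 : v <= 1 by rewrite /v lerBlDr lerDl.
pose q th := Num.sqrt (S - v * th ^+ 2).
pose H c th := gauss_tail ((a - c * th) / q th).
pose g th := p * H 0 th + v / 2 * (H 1 th + H (-1) th).
pose dH c th := c * gauss_d1 (q th) (a - c * th) - v * th * gauss_d2 (q th) (a - c * th).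
pose dg th := p * dH 0 th + v / 2 * (dH 1 th + dH (-1) th).
have e1 : g 1 = walk_step (gauss_kernel y s) w.
  have q1 : q 1 = Num.sqrt s by rewrite /q /S; congr Num.sqrt; ring.
  rewrite /g /H q1 /walk_step /gauss_kernel -/v.
  have -> : y - (w + 1) = a - 1 * 1 by rewrite /a; ring.
  have -> : y - (w - 1) = a - (-1) * 1 by rewrite /a; ring.
  by have -> : y - w = a - 0 * 1 by rewrite /a; ring.
have e0 : g 0 = gauss_kernel y (s + v) w.
  have q_0 : q 0 = Num.sqrt S by rewrite /q; congr Num.sqrt; ring.
  by rewrite /g /H q_0 /gauss_kernel -/S -/a !mulr0 !subr0 /v; field.
(* The interpolated variance never drops below [s], so the kernel stays smooth and the bound in [s0]
   is uniform in [th]. *)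
have thS th : 0 <= th <= 1 -> s <= S - v * th ^+ 2.
  move=> /andP[t0 t1]; rewrite /S -addrA lerDl subr_ge0.
  by rewrite ler_piMr ?(ltW v0)// exprn_ile1.
have [th /andP[t0 t1] e] : exists2 th, 0 < th < 1 & g 1 - g 0 = dg th * (1 - 0).
  apply: (mean_value ltr01) => th th01.
  have hS : v * th ^+ 2 < S.
    by rewrite -subr_gt0 (lt_le_trans _ (thS _ th01))// (lt_le_trans s00).
  have dHc c : is_derive th 1 (H c) (dH c th).
    exact: is_derive_gauss_tail_scaled.
  exact: is_derive_average.
rewrite -e1 -e0 e subr0 mulr1.
have th01 : 0 <= th <= 1 by rewrite !ltW.
have {thS}qs : s <= S - v * th ^+ 2 := thS _ th01.
have q2 : q th ^+ 2 = S - v * th ^+ 2.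
  by rewrite sqr_sqrtr// (le_trans _ qs)// (le_trans _ ss0)// ltW.
have q0 : 0 < q th by rewrite sqrtr_gt0 (lt_le_trans _ qs)// (lt_le_trans _ ss0).
have s0Q : s0 <= q th ^+ 2 by rewrite q2 (le_trans ss0).
have QS : q th ^+ 2 <= S by rewrite q2 gerBl mulr_ge0 ?sqr_ge0 ?(ltW v0).
pose M := 8 / Num.sqrt s0 ^+ 3 * expR (3 / 4 * l + 3 / 4 * (l ^+ 2 * S / 2 - l * a)).
have M0 : 0 <= M.
  by rewrite !mulr_ge0 ?expR_ge0// invr_ge0 exprn_ge0// sqrtr_ge0.
have -> : 16 / Num.sqrt s0 ^+ 3 * expR (3 / 4 * l) * exp_bound y l S w = M * 2.
  by rewrite /M /exp_bound expRD -/a; field; rewrite gt_eqF// sqrtr_gt0.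
apply: gauss_d2_average => //; first by rewrite t0.
by move=> u au; exact: gauss_d3_bound.
Qed.

End random_walk.

(** * Accumulating the one-step errors over the whole walk *)

Section walk_tail.
Context {R : realType} (p : R).
Hypotheses (p_ge0 : 0 <= p) (p_lt1 : p < 1).
Implicit Types (s w y l c rho : R).

(** The probability that the walk of [m] steps from 0 ends above [c], computed with the transition
    operator. *)
Definition walk_tail (m : nat) c : R :=
  iter m (walk_step p) (fun w => ((c < w)%R)%:R) 0.

Lemma walk_step_linear f g a w :
  walk_step p (fun x => f x + a * g x) w = walk_step p f w + a * walk_step p g w.
Proof. by rewrite /walk_step; ring. Qed.

(** By induction: a further step carries the accumulated error along, and [exp_bound_step] keeps it
    below the same bound at the larger variance; the new replacement adds one more copy. *)
Lemma iter_gauss_kernel y s0 l w k : 0 < s0 -> 0 <= l <= 2^-1 ->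
  `|iter k (walk_step p) (gauss_kernel y s0) w
    - gauss_kernel y (s0 + k%:R * (1 - p)) w| <=
  k%:R * (16 / Num.sqrt s0 ^+ 3 * expR (3 / 4 * l)) *
    exp_bound y l (s0 + k%:R * (1 - p)) w.
Proof.
move=> s00 /andP[l0 l1].
set K := 16 / _ ^+ 3 * _.
have K0 : 0 <= K.
  by rewrite !mulr_ge0 ?expR_ge0// invr_ge0 exprn_ge0// sqrtr_ge0.
have v0 : 0 < 1 - p by rewrite subr_gt0.
elim: k w => [|k ih] w; first by rewrite !mul0r addr0 subrr normr0.
set S := s0 + k%:R * (1 - p) in ih.
have eS : s0 + k.+1%:R * (1 - p) = S + (1 - p) by rewrite /S -natr1; ring.
rewrite iterS eS.
set f := iter k _ _ in ih *.
have hf x : f x <= gauss_kernel y S x + k%:R * K * exp_bound y l S x.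
  by move: (ih x); rewrite ler_norml => /andP[_]; lra.
have hf' x : gauss_kernel y S x + - (k%:R * K) * exp_bound y l S x <= f x.
  by move: (ih x); rewrite ler_norml => /andP[+ _]; lra.
have sS : s0 <= S by rewrite lerDl mulr_ge0// ltW.
have := @walk_step_gauss_kernel _ p p_ge0 p_lt1 y S s0 l w s00 sS l0; rewrite -/K.
have hE : k%:R * K * walk_step p (exp_bound y l S) w <=
    k%:R * K * exp_bound y l (S + (1 - p)) w.
  by apply: ler_wpM2l; [rewrite mulr_ge0|apply: exp_bound_step => //; rewrite l0].
have h1 := ler_walk_step p_ge0 p_lt1 w hf.
have h2 := ler_walk_step p_ge0 p_lt1 w hf'.
have kK : (k.+1)%:R * K * exp_bound y l (S + (1 - p)) w =
   k%:R * K * exp_bound y l (S + (1 - p)) w + K * exp_bound y l (S + (1 - p)) w.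
  by rewrite -natr1; ring.
rewrite kK.
move: h1 h2 hE; rewrite !walk_step_linear.
by rewrite !ler_norml => h1 h2 hE /andP[h3 h4]; apply/andP; split; lra.
Qed.

Definition tail_error (m : nat) s0 S y : R :=
  32 * m%:R / Num.sqrt s0 ^+ 3 * expR (- (3 / 8 * (y ^+ 2 / S))).

Lemma iter_gauss_kernel0 (m : nat) y s0 : 0 < s0 ->
  let S := s0 + m%:R * (1 - p) in
  0 <= y -> y <= S / 2 ->
  `|iter m (walk_step p) (gauss_kernel y s0) 0 - gauss_tail (y / Num.sqrt S)| <=
  tail_error m s0 S y.
Proof.
move=> s00 S y0 yS.
have S0 : 0 < S by rewrite ltr_wpDr// mulr_ge0// subr_ge0 ltW.
(* The slope [l = y / S] minimizes [l^2 S / 2 - l y], with value [- y^2 / (2 S)]; the condition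
   [y <= S / 2] says that [l <= 1/2]. *)
have l0 : 0 <= y / S by rewrite divr_ge0// ltW.
have l1 : y / S <= 2^-1 by rewrite ler_pdivrMr// mulrC.
have l01 : 0 <= y / S <= 2^-1 by rewrite l0.
have := iter_gauss_kernel y 0 m s00 l01.
rewrite -/S {2}/gauss_kernel subr0 => /le_trans; apply.
rewrite /exp_bound subr0.
have -> : (y / S) ^+ 2 * S / 2 - y / S * y = - (1 / 2) * (y ^+ 2 / S).
  by field; rewrite gt_eqF.
(* Since [l <= 1/2], the value is at most [1 / (1 - 3/8) = 8/5]; rounded up to 2, it turns the
   constant 16 into 32. *)
have e2 : expR (3 / 4 * (y / S)) <= 2.
  have hm : 1 - 3 / 4 * (y / S) <= expR (- (3 / 4 * (y / S))) by apply: expR_ge1Dx.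
  have e0 : 0 < expR (3 / 4 * (y / S)) := expR_gt0 _.
  have := ler_wpM2l (ltW e0) hm; rewrite -expRD subrr expR0 => h; nra.
have -> : 3 / 4 * (- (1 / 2) * (y ^+ 2 / S)) = - (3 / 8 * (y ^+ 2 / S)).
  by field; rewrite gt_eqF.
rewrite /tail_error ler_wpM2r ?expR_ge0//.
have -> : 32 * m%:R / Num.sqrt s0 ^+ 3 = m%:R * (16 / Num.sqrt s0 ^+ 3 * 2).
  by field; rewrite gt_eqF// sqrtr_gt0.
by rewrite ler_wpM2l// ler_wpM2l// divr_ge0// exprn_ge0// sqrtr_ge0.
Qed.

Lemma walk_tail_le (m : nat) c s0 rho : 0 < s0 ->
  let S := s0 + m%:R * (1 - p) in
  let y := c - Num.sqrt s0 * rho in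
  0 <= y -> y <= S / 2 ->
  walk_tail m c <= gauss_tail (y / Num.sqrt S) + tail_error m s0 S y + gauss_tail rho.
Proof.
move=> s00 S y y0 yS.
apply: le_trans (iter_walk_step_le p_ge0 p_lt1 m 0
  (fun w => gauss_kernel_upper c rho w s00)) _.
rewrite iter_walk_step_addc lerD2r.
by have := iter_gauss_kernel0 s00 y0 yS; rewrite -/S ler_norml => /andP[_]; lra.
Qed.

Lemma walk_tail_ge (m : nat) c s0 rho : 0 < s0 ->
  let S := s0 + m%:R * (1 - p) in
  let y := c + Num.sqrt s0 * rho in
  0 <= y -> y <= S / 2 ->
  gauss_tail (y / Num.sqrt S) - tail_error m s0 S y - gauss_tail rho <= walk_tail m c.
Proof.
move=> s00 S y y0 yS.
apply: le_trans (iter_walk_step_le p_ge0 p_lt1 m 0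
  (fun w => gauss_kernel_lower c rho w s00)).
rewrite iter_walk_step_addc lerD2r.
by have := iter_gauss_kernel0 s00 y0 yS; rewrite -/S ler_norml => /andP[+ _]; lra.
Qed.

End walk_tail.

(** * Elementary limits and the Gumbel normalization *)

Section limits_at_infinity.
Context {R : realType}.
Implicit Types (x a t : R) (k : nat).

Lemma cvg_near_eq {T : Type} {F : set_system T} {FF : Filter F} (f g : T -> R) (l : R) :
  (\forall x \near F, g x = f x) -> f x @[x --> F] --> l -> g x @[x --> F] --> l.
Proof.
move=> gf fl; apply: cvg_trans fl; apply: near_eq_cvg.
by apply: filterS gf => x ->.
Qed.

Lemma cvg_limit_eq {T : Type} {F : set_system T} (l l' : R) (f : T -> R) :
  l = l' -> f x @[x --> F] --> l -> f x @[x --> F] --> l'.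
Proof. by move->. Qed.

Lemma cvg_exprn_expRN k a : 0 < a ->
  x ^+ k * expR (- (a * x)) @[x --> +oo] --> (0 : R).
Proof.
move=> a0.
apply: (@squeeze_cvgr _ _ _ _ (cst 0) (fun x => (k.+1)`!%:R / a ^+ k.+1 * x^-1)).
- near=> x.
  have x0 : 0 < x by near: x; apply: nbhs_pinfty_gt; rewrite num_real.
  rewrite /= mulr_ge0 ?expR_ge0 ?exprn_ge0 ?(ltW x0)//=.
  have ax0 : 0 <= a * x by rewrite mulr_ge0 ?ltW.
  have := expR_ge1Dxn k ax0.
  set f := (k.+1)`!%:R.
  have f0 : 0 < f :> R by rewrite ltr0n fact_gt0.
  move=> h; have {h} : (a * x) ^+ k.+1 / f <= expR (a * x) by lra.
  rewrite ler_pdivrMr// => h.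
  rewrite expRN ler_pdivrMr ?expR_gt0//.
  rewrite -(ler_pM2l (_ : 0 < a ^+ k.+1 * x)); last by rewrite mulr_gt0 ?exprn_gt0.
  have -> : a ^+ k.+1 * x * (x ^+ k) = (a * x) ^+ k.+1.
    by rewrite exprMn [x ^+ k.+1]exprS mulrA.
  apply: (le_trans h); rewrite le_eqVlt; apply/orP; left; apply/eqP.
  by field; rewrite !gt_eqF ?exprn_gt0.
- exact: cvg_cst.
- rewrite -[X in _ --> X](mulr0 ((k.+1)`!%:R / a ^+ k.+1)); apply: cvgM.
    exact: cvg_cst.
  exact: cvgV_pinfty.
Unshelve. all: by end_near. Qed.

Lemma ln_cvgy : @ln R x @[x --> +oo] --> +oo.
Proof.
apply/cvgryPge => A; near=> x.
rewrite -[A]expRK ler_ln ?posrE ?expR_gt0//.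
Unshelve. all: by end_near. Qed.

Lemma sqrt_cvgy : Num.sqrt (2 * x : R) @[x --> +oo] --> +oo.
Proof.
apply/cvgryPge => A; near=> x.
rewrite (le_trans (ler_norm A))// -sqrtr_sqr ler_wsqrtr//.
have : A ^+ 2 <= x by near: x; apply: nbhs_pinfty_ge; rewrite num_real.
have : 0 <= x by near: x; apply: nbhs_pinfty_ge; rewrite num_real.
lra.
Unshelve. all: by end_near. Qed.

(** At [x = ln n] these give [a_n = 1 / b] and [b_n = b - c / (2 b)]. *)
Definition gumbel_b x : R := Num.sqrt (2 * x).
Definition gumbel_c x : R := ln x + ln (4 * pi).

Lemma gumbel_b_gt0 x : 0 < x -> 0 < gumbel_b x.
Proof. by move=> x0; rewrite sqrtr_gt0 mulr_gt0. Qed.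

Lemma gumbel_b_sqr x : 0 < x -> gumbel_b x ^+ 2 = 2 * x.
Proof. by move=> x0; rewrite sqr_sqrtr// mulr_ge0// ltW. Qed.

Lemma gumbel_bV_cvg0 : (gumbel_b x)^-1 @[x --> +oo] --> (0 : R).
Proof.
apply/gtr0_cvgV0; last exact: sqrt_cvgy.
near=> x; apply: gumbel_b_gt0.
by near: x; apply: nbhs_pinfty_gt; rewrite num_real.
Unshelve. all: by end_near. Qed.

Lemma gumbel_c_div_cvg0 : gumbel_c x / gumbel_b x @[x --> +oo] --> (0 : R).
Proof.
have h : ln x / gumbel_b x @[x --> +oo] --> (0 : R).
  (* With [y = ln x] the quotient [ln x / sqrt x] is [y * expR (- y / 2)]. *)
  have := cvg_comp _ _ ln_cvgy (@cvg_exprn_expRN 1 2^-1 _).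
  rewrite invr_gt0 ltr0n => /(_ isT) h0.
  apply: (@cvg_near_eq _ _ _
    (fun x => (Num.sqrt 2)^-1 * (ln x ^+ 1 * expR (- (2^-1 * ln x))))).
    near=> x.
    have x0 : 0 < x by near: x; apply: nbhs_pinfty_gt; rewrite num_real.
    have -> : expR (- (2^-1 * ln x)) = (Num.sqrt x)^-1.
      rewrite expRN; congr (_^-1).
      rewrite -[LHS]ger0_norm ?expR_ge0// -sqrtr_sqr; congr Num.sqrt.
      by rewrite expr2 -expRD -mulrDl (_ : 2^-1 + 2^-1 = 1 :> R) ?mul1r ?lnK//; field.
    rewrite /gumbel_b sqrtrM// invfM expr1; ring.
  rewrite -[X in _ --> X](mulr0 (Num.sqrt 2)^-1); apply: cvgM => //.
  exact: cvg_cst.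
apply: (@cvg_near_eq _ _ _
  (fun x => ln x / gumbel_b x + ln (4 * pi) * (gumbel_b x)^-1)).
  by near=> x; rewrite /gumbel_c mulrDl.
rewrite -[X in _ --> X]addr0 -[X in _ + X](mulr0 (ln (4 * pi))).
by apply: cvgD => //; apply: cvgM; [exact: cvg_cst|exact: gumbel_bV_cvg0].
Unshelve. all: by end_near. Qed.

End limits_at_infinity.

(** * The Gaussian tail at an extreme-value level *)

Section extreme_value.
Context {R : realType}.
Implicit Types (x t : R) (X : R -> R).

Let pinfty_gt (a : R) : \forall x \near +oo, a < x.
Proof. by apply: nbhs_pinfty_gt; rewrite num_real. Qed.

(* [X] is, up to o(1/b), the extreme-value level b + (t - c/2)/b. *)
Definition extreme_level t X :=
  gumbel_b x * (X x - gumbel_b x) + gumbel_c x / 2 @[x --> +oo] --> t.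

Lemma extreme_level_subr t X : extreme_level t X -> X x - gumbel_b x @[x --> +oo] --> (0 : R).
Proof.
move=> Xt.
apply: (@cvg_near_eq _ _ _ _ (fun x => (gumbel_b x * (X x - gumbel_b x) + gumbel_c x / 2)
   * (gumbel_b x)^-1 - 2^-1 * (gumbel_c x / gumbel_b x))).
  near=> x.
  have x0 : 0 < x by near: x; exact: pinfty_gt.
  have b0 := gumbel_b_gt0 x0.
  by field; rewrite gt_eqF.
rewrite -[X in _ --> X](subr0 0) -[X in X - _](mulr0 t) -[X in _ - X](mulr0 2^-1).
apply: cvgB; apply: cvgM => //; first exact: gumbel_bV_cvg0.
  exact: cvg_cst.
exact: gumbel_c_div_cvg0.
Unshelve. all: by end_near. Qed.

Lemma extreme_level_div t X : extreme_level t X -> X x / gumbel_b x @[x --> +oo] --> (1 : R).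
Proof.
move=> /extreme_level_subr Xt.
apply: (@cvg_near_eq _ _ _ _ (fun x => 1 + (X x - gumbel_b x) * (gumbel_b x)^-1)).
  near=> x.
  have x0 : 0 < x by near: x; exact: pinfty_gt.
  have b0 := gumbel_b_gt0 x0.
  by field; rewrite gt_eqF.
rewrite -[X in _ --> X]addr0 -[X in _ + X](mulr0 0).
apply: cvgD; first exact: cvg_cst.
by apply: cvgM => //; exact: gumbel_bV_cvg0.
Unshelve. all: by end_near. Qed.

(** A relative error [o(1/x)] and an absolute error [o(1/b)] are harmless: as [b^2 = 2 x], the
    former contributes [2 x (g - 1)] times [X / b], which tends to 1. *)
Lemma extreme_level_perturb t X g h :
  extreme_level t X ->
  x * (g x - 1) @[x --> +oo] --> (0 : R) ->
  gumbel_b x * h x @[x --> +oo] --> (0 : R) ->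
  extreme_level t (fun x => g x * X x + h x).
Proof.
move=> Xt g1 h0; rewrite /extreme_level.
apply: (@cvg_near_eq _ _ _ _ (fun x =>
  (gumbel_b x * (X x - gumbel_b x) + gumbel_c x / 2)
  + 2 * (x * (g x - 1)) * (X x / gumbel_b x) + gumbel_b x * h x)).
  near=> x.
  have x0 : 0 < x by near: x; exact: pinfty_gt.
  have b0 := gumbel_b_gt0 x0.
  have b2 := gumbel_b_sqr x0.
  have -> : 2 * (x * (g x - 1)) * (X x / gumbel_b x) = gumbel_b x * (g x - 1) * X x.
    rewrite [2 * _]mulrA -b2; field; by rewrite gt_eqF.
  ring.
rewrite -[X in _ --> X]addr0 -[X in X + _]addr0 -[X in _ + X + _](mul0r 1).
rewrite -[X in _ + X * 1 + _](mulr0 2).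
apply: cvgD => //; apply: cvgD => //; apply: cvgM; last exact: extreme_level_div Xt.
by apply: cvgM => //; exact: cvg_cst.
Unshelve. all: by end_near. Qed.

(** With [X = b + z], [X^2 / 2 = x + b z + z^2 / 2]. The [x] cancels [expR x], and [expR (c / 2) =
    sqrt (4 pi x) = b sqrt (2 pi)] cancels the normalization and, up to [X / b], the divisor [X]. *)
Lemma extreme_level_pdf t X : extreme_level t X ->
  expR x * gauss_pdf (X x) / X x @[x --> +oo] --> expR (- t).
Proof.
move=> Xt.
have d0 := extreme_level_subr Xt.
have X1 := extreme_level_div Xt.
apply: (@cvg_near_eq _ _ _ _ (fun x =>
  (X x / gumbel_b x)^-1 * expR (- (gumbel_b x * (X x - gumbel_b x) + gumbel_c x / 2)
     - (X x - gumbel_b x) * (X x - gumbel_b x) / 2))).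
  near=> x.
  have x0 : 0 < x by near: x; exact: pinfty_gt.
  have b0 := gumbel_b_gt0 x0.
  have b2 := gumbel_b_sqr x0.
  have p0 : 0 < pi :> R by exact: pi_gt0.
  rewrite /gauss_pdf.
  have -> : - (X x ^+ 2 / 2) =
     - x + (gumbel_c x / 2) + (- (gumbel_b x * (X x - gumbel_b x) + gumbel_c x / 2)
     - (X x - gumbel_b x) * (X x - gumbel_b x) / 2).
    rewrite [- x](_ : _ = - (gumbel_b x ^+ 2 / 2)); last by rewrite b2; field.
    by field.
  rewrite 2!expRD expRN.
  set E := expR (_ - _ / 2).
  have -> : expR (gumbel_c x / 2) = Num.sqrt x * Num.sqrt (4 * pi).
    rewrite /gumbel_c -lnM ?posrE ?mulr_gt0//.
    rewrite -sqrtrM ?(ltW x0)//.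
    rewrite -[LHS]ger0_norm ?expR_ge0// -sqrtr_sqr; congr Num.sqrt.
    by rewrite expr2 -expRD -splitr lnK ?posrE// !mulr_gt0.
  have -> : (4 : R) * pi = 2 * (2 * pi) by ring.
  have e1 : gumbel_b x = Num.sqrt 2 * Num.sqrt x by rewrite /gumbel_b sqrtrM.
  rewrite [Num.sqrt (2 * (2 * pi))]sqrtrM// invf_div e1.
  have s0 : Num.sqrt (2 * pi) != 0 :> R by rewrite gt_eqF// sqrtr_gt0 mulr_gt0.
  have ex0 : expR x != 0 by rewrite gt_eqF ?expR_gt0.
  have X0 : X x != 0.
    have : 0 < X x / gumbel_b x.
      by near: x; apply: cvgr_gt X1 _ _; exact: ltr01.
    by rewrite pmulr_lgt0 ?invr_gt0// => /gt_eqF ->.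
  by field; rewrite s0 X0 ex0.
rewrite -[X in _ --> X]mul1r -[X in X * _]invr1; apply: cvgM.
  by apply: cvgV => //; exact: oner_neq0.
apply: continuous_cvg; first exact: continuous_expR.
rewrite -[X in _ --> X]subr0 -[X in _ - X](mul0r 2^-1) -[X in _ - X / _](mulr0 0).
apply: cvgB; first exact: cvgN.
by apply: cvgM; [exact: cvgM|exact: cvg_cst].
Unshelve. all: by end_near. Qed.

Lemma extreme_level_cvgy t X : extreme_level t X -> X x @[x --> +oo] --> +oo.
Proof.
move=> Xt; have d0 := extreme_level_subr Xt.
apply: (@ger_cvgy _ _ _ _ (fun x => gumbel_b x - 1)).
  near=> x.
  have : -1 < X x - gumbel_b x by near: x; apply: cvgr_gt d0 _ _; rewrite ltrN10.
  lra.
apply/cvgryPge => A; near=> x.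
rewrite lerBrDr; near: x; move: (A + 1); apply/cvgryPge; exact: sqrt_cvgy.
Unshelve. all: by end_near. Qed.

Lemma extreme_level_tail t X : extreme_level t X ->
  expR x * gauss_tail (X x) @[x --> +oo] --> expR (- t).
Proof.
move=> Xt.
have pdft := extreme_level_pdf Xt.
have Xy := extreme_level_cvgy Xt.
have XV : (X x)^-1 @[x --> +oo] --> (0 : R) by apply: (cvg_comp _ _ Xy cvgV_pinfty).
apply: (@squeeze_cvgr _ _ _ _
  (fun x => expR x * gauss_pdf (X x) / X x * (1 - (X x)^-1 * (X x)^-1))
  (fun x => expR x * gauss_pdf (X x) / X x)); last exact: pdft.
- near=> x.
  have X0 : 0 < X x by near: x; move: (0 : R); apply/cvgryPgt.
  have e0 := expR_gt0 x.
  apply/andP; split; last first.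
    by rewrite -mulrA ler_pM2l//; exact: gauss_tail_le.
  have -> : expR x * gauss_pdf (X x) / X x * (1 - (X x)^-1 * (X x)^-1) =
     expR x * (gauss_pdf (X x) * ((X x)^-1 - (X x)^-1 ^+ 3)).
    by field; rewrite gt_eqF.
  by rewrite ler_pM2l//; exact: gauss_tail_ge.
- rewrite -[X in _ --> X]mulr1 -[X in _ * X]subr0 -[X in _ - X](mulr0 0).
  by apply: cvgM => //; apply: cvgB; [exact: cvg_cst|exact: cvgM].
Unshelve. all: by end_near. Qed.

End extreme_value.

(** * The smoothed and shifted level remains extreme *)

Section walk_tail_asymptotics.
Context {R : realType} (v t r e d : R).
Hypotheses (v_gt0 : 0 < v) (r_ge0 : 0 <= r).
Implicit Types x : R.

Let pinfty_gt (a : R) : \forall x \near +oo, a < x.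
Proof. by apply: nbhs_pinfty_gt; rewrite num_real. Qed.

(* Throughout this section [x] stands for [ln n]. *)
Definition smoothing_var x := expR x * v / x ^+ 4.
Definition total_var x := smoothing_var x + (expR x - r) * v.
Definition base_level x :=
  (gumbel_b x)^-1 * t + (gumbel_b x - 2^-1 * (gumbel_b x)^-1 * gumbel_c x).
(** The term [e] will absorb the games inside [J]; [d], later 1 or -1, is the direction of the
    smoothing shift by [x] standard deviations. *)
Definition shifted_level x :=
  base_level x * Num.sqrt ((expR x - 1) * v) + e + d * (Num.sqrt (smoothing_var x) * x).
Let Y x := shifted_level x / Num.sqrt (total_var x).
(** The total variance divided by [n v], shaped to match [cvg_exprn_expRN]. *)
Let D x := 1 + x^-1 ^+ 4 - r * (x ^+ 0 * expR (- (1 * x))).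

Let cvg_xV k : x^-1 ^+ k.+1 @[x --> +oo] --> (0 : R).
Proof.
rewrite -[X in _ --> X](expr0n R k.+1).
exact: (cvg_comp _ _ cvgV_pinfty (@exprn_continuous _ _ _)).
Qed.

Let D_cvg1 : D x @[x --> +oo] --> (1 : R).
Proof.
rewrite -[X in _ --> X]subr0 -[X in X - _]addr0 -[X in _ - X](mulr0 r).
apply: cvgB; first by apply: cvgD; [exact: cvg_cst|exact: cvg_xV].
by apply: cvgM; [exact: cvg_cst|exact: cvg_exprn_expRN].
Qed.

Let DV_cvg1 : (D x)^-1 @[x --> +oo] --> (1 : R).
Proof.
rewrite -[X in _ --> X]invr1; apply: (@cvgV _ _ _ _ D _ (oner_neq0 _)).
exact: D_cvg1.
Qed.

Let total_varE x : 0 < x -> total_var x = expR x * v * D x.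
Proof.
move=> x0; rewrite /total_var /smoothing_var /D mul1r expRN.
by field; rewrite !gt_eqF ?expR_gt0.
Qed.

Let D_gt0 : \forall x \near +oo, 0 < D x.
Proof. exact: (cvgr_gt _ D_cvg1 _ ltr01). Qed.

Let base_level_extreme : extreme_level t base_level.
Proof.
apply: (@cvg_near_eq _ _ _ _ (cst t)); last exact: cvg_cst.
near=> x.
have x0 : 0 < x by near: x; exact: pinfty_gt.
have b0 := gumbel_b_gt0 x0.
by rewrite /base_level /=; field; rewrite gt_eqF.
Unshelve. all: by end_near. Qed.

Let scale x := Num.sqrt ((expR x - 1) * v) / Num.sqrt (total_var x).
Let shift x := (e + d * (Num.sqrt (smoothing_var x) * x)) / Num.sqrt (total_var x).

(** As [scale] is nonnegative, [|scale - 1| <= |scale^2 - 1|], and the square is a ratio of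
    variances without roots. Smoothing alters it by about [x^-4], well below [1/x]. *)
Let scale_cvg : x * (scale x - 1) @[x --> +oo] --> (0 : R).
Proof.
pose f x := ((r - 1) * (x ^+ 1 * expR (- (1 * x))) - x^-1 ^+ 3) * (D x)^-1.
have f0 : f x @[x --> +oo] --> (0 : R).
  rewrite -[X in _ --> X](mul0r 1); apply: cvgM => //.
  apply: (@cvg_limit_eq _ _ _ ((r - 1) * 0 - 0)); first by rewrite mulr0 subr0.
  apply: cvgB => //.
  by apply: cvgM; [exact: cvg_cst|exact: cvg_exprn_expRN].
have nf0 : `|f x| @[x --> +oo] --> (0 : R).
  by rewrite -[X in _ --> X](normr0 R); exact: cvg_norm.
apply: (@squeeze_cvgr _ _ _ _ (fun x => - `|f x|) (fun x => `|f x|)) => //; last first.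
  by rewrite -[X in _ --> X]oppr0; exact: cvgN.
near=> x.
have x0 : 0 < x by near: x; exact: pinfty_gt.
have D0 : 0 < D x by near: x.
rewrite -ler_norml.
have ex1 : 1 <= expR x by rewrite -expR0 ler_expR ltW.
have n0 : 0 <= (expR x - 1) * v by rewrite mulr_ge0 ?subr_ge0// ltW.
have s0 : 0 < total_var x by rewrite total_varE// !mulr_gt0 ?expR_gt0.
have g2 : scale x ^+ 2 - 1 = f x / x.
  rewrite /scale exprMn exprVn !sqr_sqrtr ?(ltW s0)// total_varE// /f.
  have -> : expR x - 1 = expR x * (1 - expR (- (1 * x))).
    by rewrite mulrBr mulr1 mul1r -expRD subrr expR0.
  have -> : (r - 1) * (x ^+ 1 * expR (- (1 * x))) - x^-1 ^+ 3 =
      x * (1 - expR (- (1 * x)) - D x) by rewrite /D; field; rewrite gt_eqF.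
  by field; rewrite !gt_eqF ?expR_gt0.
have g0 : 0 <= scale x by rewrite divr_ge0// sqrtr_ge0.
have -> : f x = x * (scale x ^+ 2 - 1) by rewrite g2; field; rewrite gt_eqF.
rewrite !normrM ler_pM2l ?normr_gt0 ?gt_eqF//.
rewrite -[1 in leRHS](expr1n R 2) subr_sqr normrM ler_peMr//.
by rewrite ger0_norm; lra.
Unshelve. all: by end_near. Qed.

Let b_div_sqrt_cvg : gumbel_b x / Num.sqrt (total_var x) @[x --> +oo] --> (0 : R).
Proof.
apply: (@cvg_near_eq _ _ _ _ (fun x => Num.sqrt (2 / v * (x ^+ 1 * expR (- (1 * x))) * (D x)^-1))).
  near=> x.
  have x0 : 0 < x by near: x; exact: pinfty_gt.
  have D0 : 0 < D x by near: x.
  rewrite total_varE// /gumbel_b -sqrtrV ?mulr_ge0 ?expR_ge0 ?ltW//.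
  rewrite -sqrtrM ?mulr_ge0 ?ltW//; congr Num.sqrt.
  by rewrite mul1r expRN; field; rewrite !gt_eqF ?expR_gt0.
rewrite -[X in _ --> X](sqrtr0 R).
apply: continuous_cvg; first exact: sqrt_continuous.
rewrite -[X in _ --> X](mul0r 1); apply: cvgM => //.
rewrite -[X in _ --> X](mulr0 (2 / v)).
by apply: cvgM; [exact: cvg_cst|exact: cvg_exprn_expRN].
Unshelve. all: by end_near. Qed.

(** The smoothing shift is about [1 / x] of the total deviation, so multiplied by [b] it is of order
    [sqrt (2 / x)]. This is what the power [x ^+ 4] in [smoothing_var] achieves. *)
Let shift_cvg : gumbel_b x * shift x @[x --> +oo] --> (0 : R).
Proof.
apply: (@cvg_near_eq _ _ _ _ (fun x => e * (gumbel_b x / Num.sqrt (total_var x)) +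
   d * Num.sqrt (2 * x^-1 * (D x)^-1))).
  near=> x.
  have x0 : 0 < x by near: x; exact: pinfty_gt.
  have D0 : 0 < D x by near: x.
  have s0 : 0 < total_var x by rewrite total_varE// !mulr_gt0 ?expR_gt0.
  have S0 : 0 < Num.sqrt (total_var x) by rewrite sqrtr_gt0.
  suff -> : Num.sqrt (2 * x^-1 * (D x)^-1) =
     gumbel_b x * (Num.sqrt (smoothing_var x) * x) / Num.sqrt (total_var x).
    by rewrite /shift; field; rewrite gt_eqF.
  have v0 : 0 <= smoothing_var x.
    by rewrite divr_ge0 ?exprn_ge0 ?mulr_ge0 ?expR_ge0 ?ltW.
  rewrite -[RHS]ger0_norm; last first.
    by rewrite divr_ge0 ?(ltW S0)// !mulr_ge0 ?sqrtr_ge0 ?ltW.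
  rewrite -sqrtr_sqr; congr Num.sqrt.
  rewrite !exprMn exprVn gumbel_b_sqr// !sqr_sqrtr ?(ltW s0)// total_varE// /smoothing_var.
  by field; rewrite !gt_eqF ?expR_gt0.
rewrite -[X in _ --> X]addr0 -[X in X + _](mulr0 e) -[X in _ + X](mulr0 d).
apply: cvgD; first by apply: cvgM => //; exact: cvg_cst.
apply: cvgM; first exact: cvg_cst.
rewrite -[X in _ --> X](sqrtr0 R).
apply: continuous_cvg; first exact: sqrt_continuous.
rewrite -[X in _ --> X](mul0r 1); apply: cvgM => //.
rewrite -[X in _ --> X](mulr0 2).
by apply: cvgM; [exact: cvg_cst|exact: cvgV_pinfty].
Unshelve. all: by end_near. Qed.

Lemma shifted_level_extreme :
  extreme_level t (fun x => shifted_level x / Num.sqrt (total_var x)).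
Proof.
have := extreme_level_perturb base_level_extreme scale_cvg shift_cvg.
rewrite /extreme_level; apply: cvg_trans; apply: near_eq_cvg; near=> x.
suff -> : scale x * base_level x + shift x = shifted_level x / Num.sqrt (total_var x) by [].
by rewrite /scale /shift /shifted_level; ring.
Unshelve. all: by end_near. Qed.

Lemma shifted_level_ge0 : \forall x \near +oo, 0 <= shifted_level x.
Proof.
near=> x.
have : 0 <= shifted_level x / Num.sqrt (total_var x).
  near: x; move: (0 : R); apply/cvgryPge; exact: extreme_level_cvgy shifted_level_extreme.
have x0 : 0 < x by near: x; exact: pinfty_gt.
have D0 : 0 < D x by near: x.
have s0 : 0 < total_var x by rewrite total_varE// !mulr_gt0 ?expR_gt0.
by rewrite pmulr_lge0// invr_gt0 sqrtr_gt0.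
Unshelve. all: by end_near. Qed.

(** The condition [y <= S / 2] of the comparison: the level is about [b] deviations, and the
    deviation grows exponentially in [x]. *)
Lemma shifted_level_le : \forall x \near +oo, shifted_level x <= total_var x / 2.
Proof.
have h : shifted_level x / total_var x @[x --> +oo] --> (0 : R).
  apply: (@cvg_near_eq _ _ _ _ (fun x =>
    (shifted_level x / Num.sqrt (total_var x) / gumbel_b x) *
    (gumbel_b x / Num.sqrt (total_var x)))).
    near=> x.
    have x0 : 0 < x by near: x; exact: pinfty_gt.
    have D0 : 0 < D x by near: x.
    have s0 : 0 < total_var x by rewrite total_varE// !mulr_gt0 ?expR_gt0.
    have b0 := gumbel_b_gt0 x0.
    have S0 : 0 < Num.sqrt (total_var x) by rewrite sqrtr_gt0.
    rewrite -[X in _ / X](@sqr_sqrtr _ (total_var x)) ?(ltW s0)//.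
    by field; rewrite !gt_eqF.
  rewrite -[X in _ --> X](mulr0 1); apply: cvgM => //.
  exact: extreme_level_div shifted_level_extreme.
near=> x.
have x0 : 0 < x by near: x; exact: pinfty_gt.
have D0 : 0 < D x by near: x.
have s0 : 0 < total_var x by rewrite total_varE// !mulr_gt0 ?expR_gt0.
have : shifted_level x / total_var x < 2^-1.
  by near: x; apply: cvgr_lt h _ _; rewrite invr_gt0.
by rewrite ltr_pdivrMr// mulrC => /ltW.
Unshelve. all: by end_near. Qed.

(* The squared level is eventually at least [9/5 x], so the exponents of [expR x] add up to
   [1 + 1 - 3/2 - 3/8 * 9/5 = - 7/40]. *)
Lemma lindeberg_error_cvg0 :
  expR x * (32 * (expR x - r) / Num.sqrt (smoothing_var x) ^+ 3 *
    expR (- (3 / 8 * (shifted_level x ^+ 2 / total_var x)))) @[x --> +oo] --> (0 : R).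
Proof.
apply: (@squeeze_cvgr _ _ _ _ (cst 0)
  (fun x => 32 / Num.sqrt v ^+ 3 * (x ^+ 6 * expR (- (7 / 40 * x))))); last 2 first.
- exact: cvg_cst.
- rewrite -[X in _ --> X](mulr0 (32 / Num.sqrt v ^+ 3)).
  by apply: cvgM; [exact: cvg_cst|apply: cvg_exprn_expRN; lra].
near=> x.
have x0 : 0 < x by near: x; exact: pinfty_gt.
have D0 : 0 < D x by near: x.
have s0 : 0 < total_var x by rewrite total_varE// !mulr_gt0 ?expR_gt0.
have b0 := gumbel_b_gt0 x0.
have er : r <= expR x.
  by apply: le_trans (expR_ge1Dx _); have : r < x; [near: x; exact: pinfty_gt|lra].
have sv0 : 0 < Num.sqrt v by rewrite sqrtr_gt0.
have eh0 : 0 < expR (x / 2) := expR_gt0 _.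
have eh2 : expR (x / 2) ^+ 2 = expR x by rewrite expr2 -expRD -splitr.
have -> : Num.sqrt (smoothing_var x) = expR (x / 2) * Num.sqrt v / x ^+ 2.
  rewrite -[RHS]ger0_norm; last by rewrite divr_ge0 ?mulr_ge0 ?exprn_ge0 ?ltW.
  rewrite -sqrtr_sqr; congr Num.sqrt.
  rewrite !exprMn exprVn eh2 sqr_sqrtr ?(ltW v_gt0)// /smoothing_var.
  by rewrite -exprM.
have q0 : 0 < expR (x / 2) * Num.sqrt v / x ^+ 2.
  by rewrite divr_gt0 ?mulr_gt0 ?exprn_gt0.
apply/andP; split.
  rewrite mulr_ge0 ?expR_ge0// mulr_ge0 ?expR_ge0// divr_ge0 ?exprn_ge0 ?(ltW q0)//.
  by rewrite mulr_ge0// subr_ge0.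
have hY : 9 / 5 * x <= shifted_level x ^+ 2 / total_var x.
  (* The ratio tends to 1, and 19/20 suffices because [2 * (19/20)^2 = 361/200] exceeds 9/5. *)
  have hb : 19 / 20 < shifted_level x / Num.sqrt (total_var x) / gumbel_b x.
    near: x; apply: cvgr_gt (extreme_level_div shifted_level_extreme) _ _; lra.
  have : (19 / 20) ^+ 2 <= (shifted_level x / Num.sqrt (total_var x) / gumbel_b x) ^+ 2.
    by rewrite ler_sqr ?nnegrE; lra.
  have -> : (shifted_level x / Num.sqrt (total_var x) / gumbel_b x) ^+ 2 =
      shifted_level x ^+ 2 / total_var x / (2 * x).
    by rewrite !exprMn !exprVn gumbel_b_sqr// sqr_sqrtr ?(ltW s0).
  rewrite ler_pdivlMr ?mulr_gt0//.
  move: (_ / total_var x) => z; lra.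
apply: (@le_trans _ _ (expR x * (32 * expR x / (expR (x / 2) * Num.sqrt v / x ^+ 2) ^+ 3
    * expR (- (27 / 40 * x))))).
  rewrite ler_wpM2l ?expR_ge0//; apply: ler_pM.
  - by rewrite divr_ge0 ?exprn_ge0 ?(ltW q0)// mulr_ge0// subr_ge0.
  - exact: expR_ge0.
  - by rewrite ler_pM2r ?invr_gt0 ?exprn_gt0// ler_wpM2l// gerBl.
  - rewrite ler_expR; move: hY; move: (_ / total_var x) => z; lra.
rewrite le_eqVlt; apply/orP; left; apply/eqP.
have e4 : expR (x / 2) * expR (- (27 / 40 * x)) = expR (- (7 / 40 * x)).
  by rewrite -expRD; congr expR; field.
rewrite -eh2 -e4.
by field; rewrite !gt_eqF.
Unshelve. all: by end_near. Qed.

End walk_tail_asymptotics.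

(** With [rho = x = ln n], the smoothing error [gauss_tail rho] is thus [o(1/n)]. *)
Lemma expR_gauss_tail_cvg0 {R : realType} :
  expR x * gauss_tail x @[x --> +oo] --> (0 : R).
Proof.
apply: (@squeeze_cvgr _ _ _ _ (cst 0) (fun x => expR (- x))); last 2 first.
- exact: cvg_cst.
- exact: cvgr_expR.
near=> x.
have x4 : 4 < x by near: x; apply: nbhs_pinfty_gt; rewrite num_real.
have x0 : 0 < x by lra.
rewrite /= mulr_ge0 ?expR_ge0 ?gauss_tail_ge0//=.
have h : gauss_tail x <= expR (- (x ^+ 2 / 2)).
  apply: (le_trans (gauss_tail_le x0)); apply: le_trans (gauss_pdf_le x).
  by rewrite ler_pdivrMr// ler_peMr ?gauss_pdf_ge0//; lra.
apply: (@le_trans _ _ (expR x * expR (- (x ^+ 2 / 2)))).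
  by rewrite ler_pM2l ?expR_gt0.
by rewrite -expRD ler_expR; nra.
Unshelve. all: by end_near. Qed.

(** * Back from [x] to [n]: the tail of the walk is asymptotic to [expR (- t) / n] *)

Section walk_tail_cvg.
Context {R : realType}.

Lemma ln_natr_cvgy : ln (n%:R : R) @[n --> \oo] --> +oo.
Proof. exact: cvg_comp (@cvgr_idn R) (@ln_cvgy R). Qed.

(** The two smoothing bounds are used with variance [smoothing_var] and [rho = ln n], the lower one
    with [d = 1] and the upper one with [d = -1]. The limit depends neither on the [r] omitted games
    nor on the fixed shift [e]. *)
Lemma walk_tail_cvg (p t e : R) (r : nat) : 0 <= p -> p < 1 ->
  n%:R * walk_tail p (n - r) (x_n n t * Num.sqrt ((n.-1)%:R * (1 - p)) + e)
    @[n --> \oo] --> expR (- t).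
Proof.
move=> p0 p1; have v0 : 0 < 1 - p by rewrite subr_gt0.
have r0 : 0 <= r%:R :> R by [].
set v := 1 - p in v0 *.
pose err d x := expR x * (32 * (expR x - r%:R) / Num.sqrt (smoothing_var v x) ^+ 3 *
    expR (- (3 / 8 * (shifted_level v t e d x ^+ 2 / total_var v r%:R x)))).
pose main d x := expR x *
  gauss_tail (shifted_level v t e d x / Num.sqrt (total_var v r%:R x)).
pose rest x : R := expR x * gauss_tail x.
have main_cvg d : main d x @[x --> +oo] --> expR (- t).
  exact: extreme_level_tail (shifted_level_extreme _ _ _ v0).
have err_cvg d : err d x @[x --> +oo] --> (0 : R).
  exact: lindeberg_error_cvg0.
have rest_cvg : rest x @[x --> +oo] --> (0 : R) by exact: expR_gauss_tail_cvg0.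
pose lower x := main 1 x - err 1 x - rest x.
pose upper x := main (-1) x + err (-1) x + rest x.
have lower_cvg : lower x @[x --> +oo] --> expR (- t).
  by rewrite -[X in _ --> X]subr0 -[X in X - _]subr0; do 2 apply: cvgB => //.
have upper_cvg : upper x @[x --> +oo] --> expR (- t).
  by rewrite -[X in _ --> X]addr0 -[X in X + _]addr0; do 2 apply: cvgD => //.
apply: (@squeeze_cvgr _ _ _ _ (fun n => lower (ln n%:R)) (fun n => upper (ln n%:R))).
- have shifted0 d : \forall n \near \oo, 0 <= shifted_level v t e d (ln n%:R) :=
    ln_natr_cvgy (shifted_level_ge0 t r%:R e d v0).
  have shifted1 d : \forall n \near \oo, shifted_level v t e d (ln n%:R) <=
      total_var v r%:R (ln n%:R) / 2 :=
    ln_natr_cvgy (shifted_level_le t r%:R e d v0).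
  near=> n.
  have n1 : (1 < n)%N by near: n; exact: nbhs_infty_gt.
  have rn : (r <= n)%N by near: n; exact: nbhs_infty_ge.
  have n0 : 0 < n%:R :> R by rewrite ltr0n ltnW.
  have ex : expR (ln n%:R) = n%:R :> R by rewrite lnK.
  have a1 : 0 <= shifted_level v t e 1 (ln n%:R) by near: n; exact: shifted0.
  have a2 : 0 <= shifted_level v t e (-1) (ln n%:R) by near: n; exact: shifted0.
  have b1 : shifted_level v t e 1 (ln n%:R) <= total_var v r%:R (ln n%:R) / 2.
    by near: n; exact: shifted1.
  have b2 : shifted_level v t e (-1) (ln n%:R) <= total_var v r%:R (ln n%:R) / 2.
    by near: n; exact: shifted1.
  set x := ln n%:R in ex a1 a2 b1 b2 *.
  have x0 : 0 < x by rewrite ln_gt0// ltr1n.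
  have m : (n - r)%:R = expR x - r%:R by rewrite ex natrB.
  have nm : n.-1%:R = expR x - 1 by rewrite ex -subn1 natrB// ltnW.
  have s0 : 0 < smoothing_var v x.
    by rewrite divr_gt0 ?mulr_gt0 ?exprn_gt0 ?expR_gt0.
  have totE : smoothing_var v x + (n - r)%:R * (1 - p) = total_var v r%:R x by rewrite m.
  have levE d : x_n n t * Num.sqrt (n.-1%:R * v) + e + d * (Num.sqrt (smoothing_var v x) * x)
      = shifted_level v t e d x.
    by rewrite nm /x_n /a_n /b_n -/x /shifted_level.
  have lev1 := levE 1; rewrite mul1r in lev1.
  have levN1 := levE (-1); rewrite mulN1r in levN1.
  have := @walk_tail_ge R p p0 p1 (n - r) (x_n n t * Num.sqrt (n.-1%:R * v) + e)
    (smoothing_var v x) x s0; rewrite totE lev1 => /(_ a1 b1) h1.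
  have := @walk_tail_le R p p0 p1 (n - r) (x_n n t * Num.sqrt (n.-1%:R * v) + e)
    (smoothing_var v x) x s0; rewrite totE levN1 => /(_ a2 b2) h2.
  apply/andP; split.
    apply: le_trans (ler_wpM2l (ltW n0) h1).
    by rewrite /lower /main /err /rest /tail_error m -!mulrBr ex.
  apply: le_trans (ler_wpM2l (ltW n0) h2) _.
  by rewrite /upper /main /err /rest /tail_error m -!mulrDr ex.
- exact: (cvg_comp _ _ ln_natr_cvgy lower_cvg).
- exact: (cvg_comp _ _ ln_natr_cvgy upper_cvg).
Unshelve. all: by end_near. Qed.

End walk_tail_cvg.

(** * The tournament measure and the independence of cross games *)

Section tournament.
Context {R : realType} (p : R).
Hypotheses (p_ge0 : 0 <= p) (p_lt1 : p < 1).

Lemma game_weight_ge0 o : 0 <= game_weight p o.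
Proof. by rewrite /game_weight; case: ifP => // _; rewrite divr_ge0// subr_ge0 ltW. Qed.

Lemma sum_game_weight (f : 'I_3 -> R) :
  \sum_o game_weight p o * f o =
  p * f (inord 1) + (1 - p) / 2 * (f (inord 0) + f (inord 2)).
Proof.
have o0 : inord 0 = ord0 :> 'I_3 by apply: val_inj; rewrite /= inordK.
have o1 : inord 1 = lift ord0 ord0 :> 'I_3 by apply: val_inj; rewrite /= inordK.
have o2 : inord 2 = lift ord0 (lift ord0 ord0) :> 'I_3.
  by apply: val_inj; rewrite /= inordK.
rewrite 3!big_ord_recl big_ord0 /game_weight /= o0 o1 o2; ring.
Qed.

Lemma sum_game_weight1 : \sum_o game_weight p o = 1.
Proof.
under eq_bigr do rewrite -[game_weight p _]mulr1.
by rewrite (sum_game_weight (fun=> 1)); field.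
Qed.

Context {n : nat}.
Implicit Types (w : outcome n) (c : 'I_n * 'I_n) (o : 'I_3).

Definition resample w c o : outcome n := [ffun d => if d == c then o else w d].

Lemma outcome_weight_ge0 w : 0 <= outcome_weight p w.
Proof. by apply: prodr_ge0 => ij _; exact: game_weight_ge0. Qed.

Lemma outcome_weight_resample w c o :
  outcome_weight p (resample w c o) * game_weight p (w c) =
  outcome_weight p w * game_weight p o.
Proof.
rewrite /outcome_weight (bigD1 c)//= [in RHS](bigD1 c)//= ffunE eqxx.
rewrite [in LHS](eq_bigr (fun d => game_weight p (w d))); first by ring.
by move=> d /negbTE dc; rewrite ffunE dc.
Qed.

(* Exchanging the value of coordinate [c] with an independent copy preserves the weight. *)
Lemma sum_resample c (f : outcome n -> R) :
  \sum_w outcome_weight p w * f w =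
  \sum_w outcome_weight p w * \sum_o game_weight p o * f (resample w c o).
Proof.
transitivity (\sum_w \sum_o outcome_weight p w * game_weight p o * f w).
  apply: eq_bigr => w _; rewrite -mulr_suml -mulr_sumr sum_game_weight1; ring.
under [RHS]eq_bigr do rewrite mulr_sumr.
rewrite !pair_big /=.
(* Swapping the stored value at [c] with the fresh one is an involution that preserves the joint
   weight. *)
pose phi (q : outcome n * 'I_3) := (resample q.1 c q.2, q.1 c).
have phiK : involutive phi.
  move=> [w o]; rewrite /phi /=; congr pair; last by rewrite ffunE eqxx.
  by apply/ffunP => d; rewrite !ffunE; case: eqP => // ->.
rewrite (reindex_inj (inv_inj phiK)) /=.
apply: eq_bigr => -[w o] _ /=; rewrite outcome_weight_resample; ring.
Qed.

(** For distinct players, the used coordinate that stores their game, the smaller index first. *)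
Definition coord (i j : 'I_n) := if (i < j)%N then (i, j) else (j, i).

(* The doubled and centered result [2 X_ij - 1] of player [i] against player [j]. *)
Definition gain w (q : 'I_n * 'I_n) : R :=
  let o := w (coord q.1 q.2) in
  if (q.1 < q.2)%N then (val o)%:R - 1 else 1 - (val o)%:R.

Lemma gain_norm w q : `|gain w q| <= 1.
Proof.
rewrite /gain; set o := w _; case: ifP => _; rewrite ?[`|1 - _|]distrC;
by case: o => -[|[|[]]]//= _; rewrite ler_norml; apply/andP; split; lra.
Qed.

Lemma sum_gain_resample w q (h : R -> R) (u : R) :
  \sum_o game_weight p o * h (gain (resample w (coord q.1 q.2) o) q + u) =
  walk_step p h u.
Proof.
rewrite sum_game_weight /gain !ffunE eqxx /= !inordK// /walk_step.
case: ifP => _.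
  have -> : 1%:R - 1 + u = u by ring.
  have -> : 0%:R - 1 + u = u - 1 by ring.
  have -> : 2%:R - 1 + u = u + 1 by ring.
  by rewrite [h (u - 1) + _]addrC.
have -> : 1 - 1%:R + u = u by ring.
have -> : 1 - 0%:R + u = u + 1 by ring.
by have -> : 1 - 2%:R + u = u - 1 by ring.
Qed.

Lemma gain_resample_neq w c o q : coord q.1 q.2 != c ->
  gain (resample w c o) q = gain w q.
Proof. by move=> /negbTE qc; rewrite /gain !ffunE qc. Qed.

(** [coord] forgets the order of the players, but exactly one of them lies in [J]. *)
Lemma coord_inj_cross (J : {set 'I_n}) (q q' : 'I_n * 'I_n) :
  q.1 \in J -> q.2 \notin J -> q'.1 \in J -> q'.2 \notin J ->
  coord q.1 q.2 = coord q'.1 q'.2 -> q = q'.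
Proof.
case: q q' => [a b] [c d] /= aJ bJ cJ dJ; rewrite /coord.
by case: ifP => _; case: ifP => _ [e1 e2]; subst => //;
  rewrite ?aJ ?cJ in bJ dJ.
Qed.

(* A game between a player of [J] and one outside [J] enters a single factor, so that
   resampling the games of [s] one at a time turns each into one [walk_step] of that factor. *)
Lemma sum_prod_cross (J : {set 'I_n}) (s : seq ('I_n * 'I_n)) (h : 'I_n -> R -> R) :
  uniq s -> {in s, forall q, (q.1 \in J) && (q.2 \notin J)} ->
  \sum_w outcome_weight p w *
    \prod_(j in J) h j (\sum_(q <- s | q.1 == j) gain w q) =
  \prod_(j in J) iter (count (fun q => q.1 == j) s) (walk_step p) (h j) 0.
Proof.
elim: s h => [|q s ih] h /=.
  move=> _ _; under eq_bigr do under eq_bigr do rewrite big_nil.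
  rewrite -mulr_suml.
  (* With no game left, the claim is that the total mass is 1, by distributing the product over the
     sums. *)
  suff -> : \sum_(w : outcome n) outcome_weight p w = 1 by rewrite mul1r.
  have <- : \prod_(ij : 'I_n * 'I_n) \sum_(o : 'I_3) game_weight p o =
    \sum_(w : outcome n) outcome_weight p w by rewrite bigA_distr_bigA.
  by rewrite big1// => ij _; exact: sum_game_weight1.
move=> /andP[qs us] qJ.
have /andP[q1J q2J] := qJ q (mem_head _ _).
have sJ : {in s, forall q, (q.1 \in J) && (q.2 \notin J)}.
  by move=> x xs; apply: qJ; rewrite inE xs orbT.
pose h' j := if j == q.1 then walk_step p (h j) else h j.
rewrite (sum_resample (coord q.1 q.2)).
transitivity (\sum_w outcome_weight p w *
    \prod_(j in J) h' j (\sum_(q <- s | q.1 == j) gain w q)).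
  apply: eq_bigr => w _; congr (_ * _).
  rewrite [RHS](bigD1 q.1)//= /h' eqxx -(sum_gain_resample w q) mulr_suml.
  apply: eq_bigr => o _; rewrite -mulrA; congr (_ * _).
  have rs j : \sum_(q' <- s | q'.1 == j) gain (resample w (coord q.1 q.2) o) q' =
      \sum_(q' <- s | q'.1 == j) gain w q'.
    rewrite big_seq_cond [RHS]big_seq_cond; apply: eq_bigr => q' /andP[q's _].
    apply: gain_resample_neq; apply/eqP => e.
    have /andP[j1 j2] := sJ _ q's.
    by move: qs; rewrite -(coord_inj_cross j1 j2 q1J q2J e) q's.
  rewrite (bigD1 q.1)//= big_cons eqxx rs; congr (_ * _).
  apply: eq_bigr => j /andP[_ /negbTE jq].
  by rewrite big_cons eq_sym jq rs.
rewrite ih//; apply: eq_bigr => j _.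
rewrite /h' [q.1 == j]eq_sym; case: eqP => [->|_] //.
by rewrite add1n iterSr.
Qed.

Lemma sum_prod_cross_all (J : {set 'I_n}) (h : R -> R) :
  \sum_w outcome_weight p w *
    \prod_(j in J) h (\sum_(i | i \notin J) gain w (j, i)) =
  iter (n - #|J|) (walk_step p) h 0 ^+ #|J|.
Proof.
(* All cross games, each listed once; every player of [J] has [n - #|J|] of them. *)
pose s := [seq (j, i) | j <- enum J, i <- enum (~: J)].
have us : uniq s by apply: allpairs_uniq; rewrite ?enum_uniq// => -[??] [??].
have sJ : {in s, forall q, (q.1 \in J) && (q.2 \notin J)}.
  by move=> q /allpairsP[[j i] [/= + + ->]]; rewrite !mem_enum inE => -> ->.
have sumE (f : 'I_n * 'I_n -> R) j : j \in J ->
    \sum_(q <- s | q.1 == j) f q = \sum_(i | i \notin J) f (j, i).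
  move=> jJ; rewrite big_mkcond big_allpairs_dep /= big_enum /=.
  rewrite (bigD1 j)//= [X in _ + X]big1 ?addr0; last first.
    by move=> j' /andP[_ /negbTE ->]; rewrite big1.
  by rewrite eqxx big_enum; apply: eq_bigl => i; rewrite inE.
have cnt j : j \in J -> count (fun q => q.1 == j) s = (n - #|J|)%N.
  move=> jJ; rewrite /s; have -> : (n - #|J|)%N = #|~: J|.
    apply/eqP; rewrite -(eqn_add2l #|J|) cardsC card_ord subnKC//.
    by rewrite -[X in (_ <= X)%N]card_ord max_card.
  rewrite count_flatten -map_comp sumnE big_map big_enum /= (bigD1 j)//=.
  rewrite [X in (_ + X)%N]big1 ?addn0; last first.
    move=> j' /andP[_ /negbTE jj']; rewrite count_map; apply/eqP.
    by rewrite -leqn0 leqNgt -has_count; apply/hasPn => i _ /=; rewrite jj'.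
  rewrite count_map (eq_count (a2 := predT)) ?count_predT -?cardE//.
  by move=> i /=; rewrite eqxx.
transitivity (\sum_(w : outcome n) outcome_weight p w *
    \prod_(j in J) h (\sum_(q <- s | q.1 == j) gain w q)).
  by apply: eq_bigr => w _; congr (_ * _); apply: eq_bigr => j jJ; rewrite sumE.
rewrite (sum_prod_cross (fun=> h) us sJ) -[RHS]prodr_const; apply: eq_bigr => j jJ.
by rewrite cnt.
Qed.

End tournament.

(** * Factorial moments of the number of exceedances *)

Section factorial_moments.
Context {R : realType} (p : R).
Hypotheses (p_ge0 : 0 <= p) (p_lt1 : p < 1).

Definition total_gain {n : nat} (w : outcome n) (j : 'I_n) : R :=
  \sum_(i | i != j) gain w (j, i).

Lemma score_total_gain (n : nat) (w : outcome n) (j : 'I_n) :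
  score R w j = (n.-1)%:R / 2 + total_gain w j / 2.
Proof.
have -> : (n.-1)%:R / 2 = \sum_(i : 'I_n | i != j) (2^-1 : R).
  rewrite sumr_const -[RHS]mulr_natl; congr (_%:R / 2).
  by rewrite (cardC1 j) card_ord.
rewrite /total_gain mulr_suml -big_split /=; apply: eq_bigr => i ij.
rewrite /X /gain /coord /=; case: ltngtP => [_|_|e]; first by field.
  by field.
by move: ij; rewrite -val_eqE /= e eqxx.
Qed.

Lemma lt_norm_score (n : nat) (w : outcome n) (j : 'I_n) (x : R) : (1 < n)%N ->
  (x < norm_score p w j) = (x * Num.sqrt ((n.-1)%:R * (1 - p)) < total_gain w j).
Proof.
move=> n1; set q := Num.sqrt (n.-1%:R * (1 - p)).
have q0 : 0 < q by rewrite sqrtr_gt0 mulr_gt0 ?subr_gt0// ltr0n -subn1 subn_gt0.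
have -> : norm_score p w j = total_gain w j / q.
  rewrite /norm_score score_total_gain addrAC subrr add0r.
  have -> : sigma_n p n = q / 2.
    rewrite /sigma_n sqrtrM; last by rewrite mulr_ge0// subr_ge0 ltW.
    rewrite -/q sqrtrV//; congr (_ / _).
    by rewrite (_ : 4 = 2 ^+ 2) ?sqrtr_sqr ?ger0_norm// -natrX.
  by field; rewrite gt_eqF.
by rewrite ltr_pdivlMr.
Qed.

Definition exceed (n : nat) (t : R) (w : outcome n) : {set 'I_n} :=
  [set j | x_n n t < norm_score p w j].

Definition joint_exceed (n : nat) (t : R) (J : {set 'I_n}) : R :=
  \sum_w outcome_weight p w * (J \subset exceed t w)%:R.

Lemma subset_prod (T : finType) (A B : {set T}) :
  (A \subset B)%:R = \prod_(j in A) (j \in B)%:R :> R.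
Proof.
case: (boolP (A \subset B)) => [/fintype.subsetP AB|/fintype.subsetPn[j jA /negbTE jB]].
  by rewrite big1// => j jA; rewrite AB.
by rewrite (bigD1 j)//= jB mul0r.
Qed.

Lemma total_gain_cross (n : nat) (J : {set 'I_n}) (w : outcome n) (j : 'I_n) : j \in J ->
  `|total_gain w j - \sum_(i | i \notin J) gain w (j, i)| <= #|J|%:R.
Proof.
move=> jJ; rewrite /total_gain (bigID (mem J))/= [X in _ + X - _](eq_bigl (fun i => i \notin J)).
  rewrite addrK; apply: le_trans (ler_norm_sum _ _ _) _.
  apply: le_trans (_ : \sum_(i | (i != j) && (i \in J)) 1 <= _).
    by apply: ler_sum => i _; exact: gain_norm.
  rewrite sumr_const ler_nat; apply: subset_leq_card.
  by apply/fintype.subsetP => i /andP[].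
by move=> i; case: eqP => // ->; rewrite jJ.
Qed.

Let level (n : nat) (t : R) : R := x_n n t * Num.sqrt ((n.-1)%:R * (1 - p)).

Lemma ler_bool (a b : bool) : (a -> b) -> a%:R <= b%:R :> R.
Proof. by case: a; case: b => // /(_ isT). Qed.

(** If all of [J] exceed the level, each cross sum exceeds it lowered by [#|J|], and the cross sums
    are independent. The lower bound is the converse implication with the level raised. *)
Lemma joint_exceed_le (n : nat) (t : R) (J : {set 'I_n}) : (1 < n)%N ->
  joint_exceed t J <= walk_tail p (n - #|J|) (level n t + - #|J|%:R) ^+ #|J|.
Proof.
move=> n1; rewrite /walk_tail -sum_prod_cross_all//; apply: ler_sum => w _.
apply: ler_wpM2l; first exact: outcome_weight_ge0.
rewrite subset_prod; apply: ler_prod => j jJ; rewrite ler0n /=.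
apply: ler_bool; rewrite inE lt_norm_score// -/(level n t).
by have := total_gain_cross w jJ; rewrite ler_norml => /andP[_]; lra.
Qed.

Lemma joint_exceed_ge (n : nat) (t : R) (J : {set 'I_n}) : (1 < n)%N ->
  walk_tail p (n - #|J|) (level n t + #|J|%:R) ^+ #|J| <= joint_exceed t J.
Proof.
move=> n1; rewrite /walk_tail -sum_prod_cross_all//; apply: ler_sum => w _.
apply: ler_wpM2l; first exact: outcome_weight_ge0.
rewrite subset_prod; apply: ler_prod => j jJ; rewrite ler0n /=.
apply: ler_bool; rewrite inE lt_norm_score// -/(level n t).
by have := total_gain_cross w jJ; rewrite ler_norml => /andP[+ _]; lra.
Qed.

Definition factorial_moment (t : R) (r n : nat) : R :=
  \sum_(w : outcome n) outcome_weight p w * ('C(S_n p t w, r))%:R.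

(** The binomial coefficient counts the [r]-subsets of the set of exceeding players. *)
Lemma factorial_momentE (t : R) (r n : nat) :
  factorial_moment t r n = \sum_(J : {set 'I_n} | #|J| == r) joint_exceed t J.
Proof.
rewrite /joint_exceed exchange_big /=; apply: eq_bigr => w _.
rewrite -mulr_sumr -/(exceed t w); congr (_ * _).
rewrite /S_n -/(exceed t w) -cards_draws -sum1_card natr_sum big_mkcond.
rewrite [RHS]big_mkcond; apply: eq_bigr => J _; rewrite !inE.
by case: (_ == r); case: (_ \subset _).
Qed.

Lemma factorial_moment_bounds (t : R) (r n : nat) : (1 < n)%N ->
  ('C(n, r))%:R * walk_tail p (n - r) (level n t + r%:R) ^+ r <=
  factorial_moment t r n <=
  ('C(n, r))%:R * walk_tail p (n - r) (level n t + - r%:R) ^+ r.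
Proof.
move=> n1; rewrite factorial_momentE.
have cst (a : R) : ('C(n, r))%:R * a = \sum_(J : {set 'I_n} | #|J| == r) a.
  rewrite sumr_const -[RHS]mulr_natl; congr (_%:R * _).
  by rewrite -[in LHS](card_ord n) -card_draws cardsE.
rewrite !cst; apply/andP; split; apply: ler_sum => J /eqP <-.
  exact: joint_exceed_ge.
exact: joint_exceed_le.
Qed.

Lemma bin_div_exp_cvg (r : nat) :
  ('C(n, r))%:R / n%:R ^+ r @[n --> \oo] --> (r`!%:R : R)^-1.
Proof.
have nV : (n%:R : R)^-1 @[n --> \oo] --> (0 : R).
  exact: cvg_comp (@cvgr_idn R) (@cvgV_pinfty R).
have h : (n ^_ r)%:R / n%:R ^+ r @[n --> \oo] --> (1 : R).
  elim: r => [|r ih].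
    by apply: (@cvg_near_eq _ _ _ _ (cst 1)); [near=> n; rewrite divr1|exact: cvg_cst].
  apply: (@cvg_near_eq _ _ _ _
     (fun n => (n ^_ r)%:R / n%:R ^+ r * (1 - r%:R * (n%:R)^-1))).
    near=> n.
    have rn : (r < n)%N by near: n; exact: nbhs_infty_gt.
    have n0 : n%:R != 0 :> R by rewrite pnatr_eq0 -lt0n (leq_trans _ rn).
    rewrite ffactnSr natrM natrB ?(ltnW rn)// exprSr.
    by field; rewrite n0 expf_neq0.
  apply: (@cvg_limit_eq _ _ _ (1 * (1 - r%:R * 0))); first by rewrite mulr0 subr0 mulr1.
  by apply: cvgM => //; apply: cvgB; [exact: cvg_cst|apply: cvgM => //; exact: cvg_cst].
apply: (@cvg_near_eq _ _ _ _ (fun n => (n ^_ r)%:R / n%:R ^+ r * (r`!%:R)^-1)).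
  near=> n; rewrite -bin_ffact natrM.
  have f0 : r`!%:R != 0 :> R by rewrite pnatr_eq0 -lt0n fact_gt0.
  by rewrite -!mulrA; congr (_ * _); rewrite mulrCA divff// mulr1.
rewrite -[X in _ --> X]mul1r; apply: cvgM => //; exact: cvg_cst.
Unshelve. all: by end_near. Qed.

Lemma factorial_moment_cvg (t : R) (r : nat) :
  factorial_moment t r n @[n --> \oo] --> expR (- t) ^+ r / r`!%:R.
Proof.
have lim e : ('C(n, r))%:R * walk_tail p (n - r) (level n t + e) ^+ r
    @[n --> \oo] --> expR (- t) ^+ r / r`!%:R.
  (* The powers of [n] are regrouped, so that the walk tail appears multiplied by [n]. *)
  apply: (@cvg_near_eq _ _ _ _ (fun n =>
    (n%:R * walk_tail p (n - r) (level n t + e)) ^+ r * (('C(n, r))%:R / n%:R ^+ r))).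
    near=> n.
    have n0 : n%:R != 0 :> R.
      by rewrite pnatr_eq0 -lt0n; near: n; exact: nbhs_infty_gt.
    by rewrite exprMn; field; rewrite expf_neq0.
  apply: cvgM; last exact: bin_div_exp_cvg.
  apply: (@continuous_cvg _ _ _ _ _ _ (fun x : R => x ^+ r)).
    exact: exprn_continuous.
  exact: walk_tail_cvg.
apply: (@squeeze_cvgr _ _ _ _
  (fun n => ('C(n, r))%:R * walk_tail p (n - r) (level n t + r%:R) ^+ r)
  (fun n => ('C(n, r))%:R * walk_tail p (n - r) (level n t + - r%:R) ^+ r)) => //.
near=> n; apply: factorial_moment_bounds.
by near: n; exact: nbhs_infty_gt.
Unshelve. all: by end_near. Qed.

End factorial_moments.

(** * Truncated inclusion-exclusion and the Poisson limit *)

Lemma mul_bin_bin (k N i : nat) :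
  ('C(k + N, k + i) * 'C(k + i, k) = 'C(k + N, k) * 'C(N, i))%N.
Proof.
have [iN|Ni] := leqP i N; last by rewrite (bin_small Ni) muln0 bin_small ?ltn_add2l.
have f0 : (0 < k`! * (i`! * (N - i)`!))%N by rewrite !muln_gt0 !fact_gt0.
apply/eqP; rewrite -(eqn_pmul2r f0); apply/eqP.
have h1 : ('C(k + i, k) * (k`! * i`!) = (k + i)`!)%N.
  by have := bin_fact (leq_addr i k); rewrite addKn.
have h2 : ('C(k + N, k + i) * ((k + i)`! * (N - i)`!) = (k + N)`!)%N.
  have : (k + i <= k + N)%N by rewrite leq_add2l.
  by move/bin_fact; rewrite subnDl.
have h3 : ('C(k + N, k) * (k`! * N`!) = (k + N)`!)%N.
  by have := bin_fact (leq_addr N k); rewrite addKn.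
have h4 := bin_fact iN.
transitivity (k + N)`!.
  by rewrite -h2 -h1; ring.
by rewrite -h3 -h4; ring.
Qed.

Section poisson_limit.
Context {R : realType}.

Lemma alternating_sum_bin (N m : nat) :
  \sum_(i < m.+1) (-1) ^+ i * ('C(N.+1, i))%:R = (-1) ^+ m * ('C(N, m))%:R :> R.
Proof.
elim: m => [|m ih]; first by rewrite big_ord_recl big_ord0 !bin0 addr0.
by rewrite big_ord_recr /= ih binS natrD exprS; ring.
Qed.

(** For [S = k + N], [mul_bin_bin] factors out ['C(S, k)] and leaves a partial alternating sum of
    row [N]. It is 1 for [N = 0]; otherwise it is ['C(N - 1, m)] up to sign, at most ['C(N, m + 1)]
    by Pascal's rule. For [S < k] every term vanishes. *)
Lemma bonferroni (S k m : nat) :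
  `|(S == k)%:R - \sum_(i < m.+1) (-1) ^+ i * (('C(k + i, k))%:R * ('C(S, k + i))%:R)|
    <= ('C(k + m.+1, k))%:R * ('C(S, k + m.+1))%:R :> R.
Proof.
have [Sk|kS] := ltnP S k.
  rewrite (ltn_eqF Sk) big1 ?subrr ?normr0 ?mulr_ge0//.
  by move=> i _; rewrite [X in _ * (_ * X%:R)]bin_small ?mulr0// ltn_addr.
have [N ->] : exists N, S = (k + N)%N by exists (S - k)%N; rewrite subnKC.
have binE i : ('C(k + i, k))%:R * ('C(k + N, k + i))%:R =
    ('C(k + N, k))%:R * ('C(N, i))%:R :> R.
  by rewrite -!natrM mulnC mul_bin_bin.
rewrite binE; under eq_bigr do rewrite binE mulrCA.
rewrite -mulr_sumr -[X in (_ == X)]addn0 eqn_add2l.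
case: N {kS binE} => [|N].
  rewrite big_ord_recl big1 ?addn0 ?binn ?bin0 ?mul1r ?addr0 ?expr0 ?mulr1; last first.
    by move=> i _; rewrite bin_small// mulr0.
  by rewrite subrr normr0.
rewrite alternating_sum_bin sub0r normrN normrM ger0_norm// ler_wpM2l//.
rewrite normrM normrX normrN1 expr1n mul1r ger0_norm// ler_nat binS.
exact: leq_addl.
Qed.

(** First [m] is fixed so that the partial exponential series is near its limit and the first
    omitted term is small; then [n] grows, with finitely many moments involved. The four errors are
    [eps / 4] each. *)
Lemma poisson_of_factorial_moments (l : R) (k : nat) (q : nat -> R) (M : nat -> nat -> R) :
  (forall n m, `|q n - \sum_(i < m.+1) (-1) ^+ i * (('C(k + i, k))%:R * M (k + i)%N n)|
    <= ('C(k + m.+1, k))%:R * M (k + m.+1)%N n) ->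
  (forall r, M r n @[n --> \oo] --> l ^+ r / r`!%:R) ->
  q n @[n --> \oo] --> expR (- l) * l ^+ k / k`!%:R.
Proof.
move=> qM Ml.
have f0 j : j`!%:R != 0 :> R by rewrite pnatr_eq0 -lt0n fact_gt0.
have coefE i : ('C(k + i, k))%:R * (l ^+ (k + i) / (k + i)`!%:R) =
    l ^+ k / k`!%:R * (l ^+ i / i`!%:R).
  have := bin_fact (leq_addr i k); rewrite addKn => <-.
  have b0 : ('C(k + i, k))%:R != 0 :> R by rewrite pnatr_eq0 -lt0n bin_gt0 leq_addr.
  by rewrite !natrM exprD; field; rewrite b0 !f0.
pose part m := \sum_(i < m.+1) (-1) ^+ i * (l ^+ k / k`!%:R * (l ^+ i / i`!%:R)).
have partE m : part m = l ^+ k / k`!%:R * series (exp_coeff (- l)) m.+1.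
  rewrite /part /series /= big_mkord mulr_sumr; apply: eq_bigr => i _.
  by rewrite /exp_coeff /= [in RHS]exprNn; ring.
have part_cvg : part m @[m --> \oo] --> expR (- l) * l ^+ k / k`!%:R.
  have -> : expR (- l) * l ^+ k / k`!%:R = l ^+ k / k`!%:R * expR (- l) by ring.
  under eq_fun do rewrite partE.
  apply: cvgM; first exact: cvg_cst.
  have := is_cvg_series_exp_coeff (- l); move=> h.
  by rewrite cvg_shiftS; exact: h.
have term_cvg : l ^+ k / k`!%:R * (l ^+ m.+1 / (m.+1)`!%:R) @[m --> \oo] --> (0 : R).
  rewrite -[X in _ --> X](mulr0 (l ^+ k / k`!%:R)); apply: cvgM; first exact: cvg_cst.
  have := cvg_exp_coeff l; rewrite -cvg_shiftS; exact.
apply/cvgrPdist_lt => eps eps0.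
have e4 : 0 < eps / 4 by rewrite divr_gt0.
move/cvgrPdist_lt : (part_cvg) => /(_ _ e4) h1.
move/cvgrPdist_lt : (term_cvg) => /(_ _ e4) h2.
have [m [m1 m2]] := @filter_ex _ _ _ _ (filterI h1 h2).
have c1 : \sum_(i < m.+1) (-1) ^+ i * (('C(k + i, k))%:R * M (k + i)%N n)
    @[n --> \oo] --> part m.
  rewrite /part; under eq_bigr do rewrite -coefE.
  apply: cvg_big; first exact: add_continuous.
  by move=> i _; do 2 (apply: cvgM; first exact: cvg_cst); exact: Ml.
have c2 : ('C(k + m.+1, k))%:R * M (k + m.+1)%N n @[n --> \oo] -->
    l ^+ k / k`!%:R * (l ^+ m.+1 / (m.+1)`!%:R).
  by rewrite -coefE; apply: cvgM; [exact: cvg_cst|exact: Ml].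
move/cvgrPdist_lt : c1 => /(_ _ e4) c1; move/cvgrPdist_lt : c2 => /(_ _ e4) c2.
near=> n.
have d1 : `|part m - \sum_(i < m.+1) (-1) ^+ i * (('C(k + i, k))%:R * M (k + i)%N n)|
    < eps / 4 by near: n.
have d2 : `|l ^+ k / k`!%:R * (l ^+ m.+1 / (m.+1)`!%:R) -
    ('C(k + m.+1, k))%:R * M (k + m.+1)%N n| < eps / 4 by near: n.
have d3 := qM n m.
move: d1 d2 d3 m1 m2; rewrite sub0r normrN.
move: (\sum_(i < _) _) (_ * M _ n) (_ * (_ / (m.+1)`!%:R)) (part m) (expR _ * _ / _) (q n).
move=> x1 x2 x3 x4 x5 x6; rewrite !ltr_norml ler_norml.
by move=> /andP[? ?] /andP[? ?] /andP[? ?] /andP[? ?] /andP[? ?]; apply/andP; split; lra.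
Unshelve. all: by end_near. Qed.

End poisson_limit.

(** * Averaging over outcomes, and the conclusion *)

Lemma prob_S_eq_bonferroni {R : realType} (p t : R) (k n m : nat) : 0 <= p -> p < 1 ->
  `|prob_S_eq p t k n - \sum_(i < m.+1) (-1) ^+ i *
      (('C(k + i, k))%:R * factorial_moment p t (k + i) n)|
  <= ('C(k + m.+1, k))%:R * factorial_moment p t (k + m.+1) n.
Proof.
move=> p0 p1.
have -> : prob_S_eq p t k n =
    \sum_(w : outcome n) outcome_weight p w * (S_n p t w == k)%:R.
  rewrite /prob_S_eq big_mkcond; apply: eq_bigr => w _.
  by case: (_ == k); rewrite ?mulr1 ?mulr0.
have -> : \sum_(i < m.+1) (-1) ^+ i * (('C(k + i, k))%:R * factorial_moment p t (k + i) n)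
  = \sum_(w : outcome n) outcome_weight p w * \sum_(i < m.+1) (-1) ^+ i *
      (('C(k + i, k))%:R * ('C(S_n p t w, k + i))%:R).
  under [RHS]eq_bigr do rewrite mulr_sumr.
  rewrite exchange_big /=; apply: eq_bigr => i _.
  rewrite /factorial_moment !mulr_sumr; apply: eq_bigr => w _; ring.
rewrite /factorial_moment mulr_sumr -sumrB.
apply: le_trans (ler_norm_sum _ _ _) _; apply: ler_sum => w _.
rewrite -mulrBr normrM ger0_norm ?outcome_weight_ge0// mulrCA.
by apply: ler_wpM2l; [exact: outcome_weight_ge0|exact: bonferroni].
Qed.


Theorem theorem1 (R : realType) (p : R)
    (hp : p = 0 \/ (3^-1 <= p /\ p < 1)) (t : R) (k : nat) :
  (fun n : nat => prob_S_eq p t k n) @ \oo -->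
    expR (- expR (- t)) * (expR (- t)) ^+ k / (k`!)%:R.
Proof.
have [p0 p1] : 0 <= p /\ p < 1.
  by case: hp => [->|[p3 p1]]; [rewrite lexx ltr01|split => //; lra].
apply: (@poisson_of_factorial_moments _ _ _ _ (factorial_moment p t)).
  by move=> n m; exact: prob_S_eq_bonferroni.
by move=> r; exact: factorial_moment_cvg.
Qed.
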